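(* Let $k$ be a field, $n\ge 1$ and $F\in GL_n(k)$. Then $H(F)$ is a Hopf algebra with comultiplication $\Delta(u_{ij})=\sum_k u_{ik}\otimes u_{kj}$, $\Delta(v_{ij})=\sum_k v_{ik}\otimes v_{kj}$, with counit $\varepsilon(u_{ij})=\delta_{ij}=\varepsilon(v_{ij})$, and with antipode $S(u)={}^tv$, $S(v)=F\,{}^tu\,F^{-1}$. The antipode of $H(F)$ is bijective and its inverse is given by $S^{-1}(u)={}^tF\,{}^tv\,{}^tF^{-1}$ and $S^{-1}(v)={}^tu$. There is a sovereign character $\Phi_F$ on $H(F)$ defined by $\Phi_F(u)={}^tF$ and $\Phi_F(v)=F^{-1}$, and hence $(H(F),\Phi_F)$ is a cosovereign Hopf algebra. If $A$ is a Hopf $k$-algebra with bijective antipode and if $V$ is a finite-dimensional (right) $A$-comodule with coaction $\alpha_V:V\to V\otimes A$ such that $V^\vee\cong{}^\vee V$ (as $A$-comodules), then there are a matrix $F\in GL_n(k)$ ($n=\dim V$), a coaction $\beta_V:V\to V\otimes H(F)$ and a Hopf algebra morphism $\pi:H(F)\to A$ such that $(1_V\otimes\pi)\circ\beta_V=\alpha_V$. In particular, for every finite type cosovereign Hopf algebra $(A,\Phi)$, there is a surjective Hopf algebra morphism $\pi:H(F)\to A$ for some matrix $F\in GL_n(k)$ (for some $n$).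
   Context: For $F\in GL_n(k)$, $H(F)$ is the universal (unital associative) $k$-algebra with generators $(u_{ij})_{1\le i,j\le n}$, $(v_{ij})_{1\le i,j\le n}$ and relations, written with the matrices $u=(u_{ij})$, $v=(v_{ij})$: $$u\,{}^tv={}^tv\,u=1,\qquad vF\,{}^tu\,F^{-1}=F\,{}^tu\,F^{-1}v=1,$$ where ${}^tx$ denotes the transpose matrix of $x$. A linear map is applied to a matrix entrywise. For a Hopf algebra $A$ with bijective antipode $S$, a sovereign character is a character (unital algebra morphism) $\Phi:A\to k$ with $S^{-1}=\Phi*S*\Phi^{-1}$ ($*$ convolution, $\Phi^{-1}$ the convolution inverse). A cosovereign Hopf algebra is a pair $(A,\Phi)$ with $A$ a Hopf algebra with bijective antipode and $\Phi$ a sovereign character on $A$. ''Finite type'' means finitely generated as an algebra. For a finite-dimensional right $A$-comodule $V$ with basis $(v_i)$ and coaction $\alpha_V(v_i)=\sum_j v_j\otimes a_{ji}$, the left dual ${}^\vee V$ and right dual $V^\vee$ are the comodules with underlying space $V^*$ and coactions $\alpha_{{}^\vee V}(v_i^* )=\sum_j v_j^*\otimes S(a_{ij})$ and $\alpha_{V^\vee}(v_i^* )=\sum_j v_j^*\otimes S^{-1}(a_{ij})$, where $(v_i^* )$ is the dual basis. *)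

(* Defs.v *)
From HB Require Import structures.
From mathcomp Require Import all_boot all_algebra generic_quotient ring_quotient.
From mathcomp Require Import finmap.
From mathcomp.multinomials Require Import monalg.
From mathcomp Require Import boolp.

Set Implicit Arguments.
Unset Strict Implicit.
Unset Printing Implicit Defensive.

Import GRing.Theory.

Local Open Scope ring_scope.
Local Open Scope quotient_scope.

Section Span.
Variables (k : pzRingType) (V : lmodType k).

Inductive in_lspan (P : V -> Prop) : V -> Prop :=
| in_lspan0 : in_lspan P 0
| in_lspan_gen x : P x -> in_lspan P x
| in_lspanDZ a x y : in_lspan P x -> in_lspan P y -> in_lspan P (a *: x + y).

Definition lspan (P : V -> Prop) : {pred V} := fun x => `[< in_lspan P x >].

Variable P : V -> Prop.

Lemma lspanP x : reflect (in_lspan P x) (x \in lspan P).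
Proof. exact: asboolP. Qed.

Fact lspan_submod_closed : submod_closed (lspan P).
Proof.
split; first exact/lspanP/in_lspan0.
by move=> a x y /lspanP Px /lspanP Py; apply/lspanP/in_lspanDZ.
Qed.

HB.instance Definition _ := GRing.isSubmodClosed.Build k V (lspan P)
  lspan_submod_closed.

Lemma lspan_gen x : P x -> x \in lspan P.
Proof. by move=> Px; apply/lspanP/in_lspan_gen. Qed.

Lemma lspan_ind (Q : V -> Prop) :
  Q 0 -> (forall x, P x -> Q x) ->
  (forall a x y, Q x -> Q y -> Q (a *: x + y)) ->
  forall x, x \in lspan P -> Q x.
Proof.
move=> Q0 Qg QDZ x /lspanP; elim=> [|y Py|a y z _ Qy _ Qz] //.
  exact: Qg.
exact: QDZ.
Qed.

End Span.

(* The k-module V / span P: [ring_quotient] provides the additive group. *)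
Section ModuleQuotient.
Variables (k : pzRingType) (V : lmodType k) (P : V -> Prop).

Definition lquot : Type := Quotient.quot (lspan P).
HB.instance Definition _ := GRing.Zmodule.on lquot.

Definition lquot_pi (x : V) : lquot := \pi_(Quotient.quot (lspan P)) x.
Definition lquot_repr (x : lquot) : V := repr (x : Quotient.quot (lspan P)).

Lemma lquot_piP x y : lquot_pi x = lquot_pi y <-> x - y \in lspan P.
Proof. by rewrite /lquot_pi Quotient.idealrBE; split=> [->|/eqP]. Qed.

Lemma lquot_reprK : cancel lquot_repr lquot_pi.
Proof. exact: reprK. Qed.

Lemma lquot_reprP (x : V) : lquot_repr (lquot_pi x) - x \in lspan P.
Proof. by apply/lquot_piP; rewrite lquot_reprK. Qed.

Lemma lquot_piD x y : lquot_pi (x + y) = lquot_pi x + lquot_pi y.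
Proof. exact: Quotient.pi_add. Qed.

Definition lquot_scale (a : k) (x : lquot) : lquot :=
  lquot_pi (a *: lquot_repr x).

Lemma lquot_piZ a x : lquot_pi (a *: x) = lquot_scale a (lquot_pi x).
Proof.
by apply/esym/lquot_piP; rewrite -scalerBr rpredZ // lquot_reprP.
Qed.

Fact lquot_scaleA a b x :
  lquot_scale a (lquot_scale b x) = lquot_scale (a * b) x.
Proof. by rewrite -[x]lquot_reprK -!lquot_piZ scalerA. Qed.

Fact lquot_scale1 : left_id 1 lquot_scale.
Proof. by move=> x; rewrite -[x]lquot_reprK -!lquot_piZ scale1r. Qed.

Fact lquot_scaleDr : right_distributive lquot_scale +%R.
Proof.
move=> a x y; rewrite -[x]lquot_reprK -[y]lquot_reprK.
by rewrite -!(lquot_piZ, lquot_piD) scalerDr.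
Qed.

Fact lquot_scaleDl x : {morph lquot_scale^~ x : a b / a + b}.
Proof.
by move=> a b; rewrite -[x]lquot_reprK -!(lquot_piZ, lquot_piD) scalerDl.
Qed.

HB.instance Definition _ := GRing.Zmodule_isLmodule.Build k lquot
  lquot_scaleA lquot_scale1 lquot_scaleDr lquot_scaleDl.

Fact lquot_pi_linear : linear lquot_pi.
Proof. by move=> a x y; rewrite lquot_piD lquot_piZ. Qed.

HB.instance Definition _ := GRing.isLinear.Build k V lquot _ lquot_pi
  lquot_pi_linear.

End ModuleQuotient.

(* The algebra A / (P), where (P) is the two-sided ideal generated by P; (P) must
   be proper because an algType is never the zero ring. *)
Section AlgebraQuotient.
Variables (k : comPzRingType) (A : algType k) (P : A -> Prop).

Definition ideal_gens (x : A) : Prop := exists a b r, P r /\ x = a * r * b.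

Lemma ideal_mull a x : x \in lspan ideal_gens -> a * x \in lspan ideal_gens.
Proof.
apply: (lspan_ind (Q := fun x => a * x \in _))
  => [|_ [b [c [r [Pr ->]]]]|d y z Iy Iz].
- by rewrite mulr0 rpred0.
- by apply: lspan_gen; exists (a * b), c, r; rewrite !mulrA.
- by rewrite mulrDr -scalerAr rpredD // rpredZ.
Qed.

Lemma ideal_mulr a x : x \in lspan ideal_gens -> x * a \in lspan ideal_gens.
Proof.
apply: (lspan_ind (Q := fun x => x * a \in _))
  => [|_ [b [c [r [Pr ->]]]]|d y z Iy Iz].
- by rewrite mul0r rpred0.
- by apply: lspan_gen; exists b, (c * a), r; rewrite !mulrA.
- by rewrite mulrDl -scalerAl rpredD // rpredZ.
Qed.

Definition aquot of 1 \notin lspan ideal_gens : Type := lquot ideal_gens.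

Variable P1 : 1 \notin lspan ideal_gens.
Local Notation Q := (aquot P1).

HB.instance Definition _ := GRing.Lmodule.on Q.

Definition aquot_pi (x : A) : Q := lquot_pi ideal_gens x.
Definition aquot_repr (x : Q) : A := lquot_repr x.

Lemma aquot_piP x y : aquot_pi x = aquot_pi y <-> x - y \in lspan ideal_gens.
Proof. exact: lquot_piP. Qed.

Lemma aquot_reprK : cancel aquot_repr aquot_pi.
Proof. exact: lquot_reprK. Qed.

Definition aquot_mul (x y : Q) : Q := aquot_pi (aquot_repr x * aquot_repr y).

Lemma aquot_piM x y : aquot_pi (x * y) = aquot_mul (aquot_pi x) (aquot_pi y).
Proof.
apply/esym; rewrite /aquot_mul; apply/aquot_piP.
set x' := aquot_repr _; set y' := aquot_repr _.
rewrite (_ : _ - _ = (x' - x) * y' + x * (y' - y)); last first.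
  by rewrite mulrBl mulrBr addrA subrK.
by apply: rpredD; [apply: ideal_mulr | apply: ideal_mull];
  exact: lquot_reprP.
Qed.

Fact aquot_piD x y : aquot_pi (x + y) = aquot_pi x + aquot_pi y.
Proof. exact: lquot_piD. Qed.

Fact aquot_mulA : associative aquot_mul.
Proof.
move=> x y z; rewrite -[x]aquot_reprK -[y]aquot_reprK -[z]aquot_reprK.
by rewrite -!aquot_piM mulrA.
Qed.

Fact aquot_mul1l : left_id (aquot_pi 1) aquot_mul.
Proof. by move=> x; rewrite -[x]aquot_reprK -aquot_piM mul1r. Qed.

Fact aquot_mul1r : right_id (aquot_pi 1) aquot_mul.
Proof. by move=> x; rewrite -[x]aquot_reprK -aquot_piM mulr1. Qed.

Fact aquot_mulDl : left_distributive aquot_mul +%R.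
Proof.
move=> x y z; rewrite -[x]aquot_reprK -[y]aquot_reprK -[z]aquot_reprK.
by rewrite -!(aquot_piM, aquot_piD) mulrDl.
Qed.

Fact aquot_mulDr : right_distributive aquot_mul +%R.
Proof.
move=> x y z; rewrite -[x]aquot_reprK -[y]aquot_reprK -[z]aquot_reprK.
by rewrite -!(aquot_piM, aquot_piD) mulrDr.
Qed.

Fact aquot_oner_neq0 : aquot_pi 1 != 0.
Proof.
apply: contra P1 => /eqP e; rewrite -[1]subr0.
by apply/aquot_piP; rewrite e /aquot_pi linear0.
Qed.

HB.instance Definition _ := GRing.Zmodule_isNzRing.Build Q
  aquot_mulA aquot_mul1l aquot_mul1r aquot_mulDl aquot_mulDr aquot_oner_neq0.

Fact aquot_pi_linear : linear aquot_pi.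
Proof. exact: lquot_pi_linear. Qed.

HB.instance Definition _ := GRing.isLinear.Build k A Q _ aquot_pi
  aquot_pi_linear.

Fact aquot_pi_monoid_morphism : monoid_morphism aquot_pi.
Proof. by split=> // x y; exact: aquot_piM. Qed.

HB.instance Definition _ := GRing.isMonoidMorphism.Build A Q aquot_pi
  aquot_pi_monoid_morphism.

Let piZ a x : aquot_pi (a *: x) = a *: aquot_pi x.
Proof. exact: linearZ_LR. Qed.

Let piM x y : aquot_pi (x * y) = aquot_pi x * aquot_pi y.
Proof. exact: aquot_piM. Qed.

Fact aquot_scalerAl (a : k) (x y : Q) : a *: (x * y) = (a *: x) * y.
Proof.
by rewrite -[x]aquot_reprK -[y]aquot_reprK -piM -!piZ -piM scalerAl.
Qed.

HB.instance Definition _ := GRing.Lmodule_isLalgebra.Build k Q aquot_scalerAl.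

Fact aquot_scalerAr (a : k) (x y : Q) : a *: (x * y) = x * (a *: y).
Proof.
by rewrite -[x]aquot_reprK -[y]aquot_reprK -piM -!piZ -piM scalerAr.
Qed.

HB.instance Definition _ := GRing.Lalgebra_isAlgebra.Build k Q aquot_scalerAr.

End AlgebraQuotient.

(* Tensor product over k: the free module on U * V modulo bilinearity. *)
Section Tensor.
Variables (k : fieldType) (U V : lmodType k).

Local Notation free := {malg k[(U * V)%type]}.

Inductive tensor_rel : free -> Prop :=
| tensor_rell a u u' v :
    tensor_rel (<< (a *: u + u', v) >> - (a *: << (u, v) >> + << (u', v) >>))
| tensor_relr a u v v' :
    tensor_rel (<< (u, a *: v + v') >> - (a *: << (u, v) >> + << (u, v') >>)).

Definition tensor : Type := lquot tensor_rel.
HB.instance Definition _ := GRing.Lmodule.on tensor.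

Definition tpure (u : U) (v : V) : tensor :=
  lquot_pi tensor_rel << (u, v) >>.

Local Notation "u ⊗ v" := (tpure u v) (at level 40, left associativity).

Lemma tpure_linearl v : linear (tpure^~ v).
Proof.
move=> a u u'; rewrite /tpure -[RHS]linearP.
by apply/lquot_piP/lspan_gen/tensor_rell.
Qed.

Lemma tpure_linearr u : linear (tpure u).
Proof.
move=> a v v'; rewrite /tpure -[RHS]linearP.
by apply/lquot_piP/lspan_gen/tensor_relr.
Qed.

Definition bilin (W : lmodType k) (f : U -> V -> W) : Prop :=
  (forall v, linear (f^~ v)) /\ (forall u, linear (f u)).

Section Lift.
Variables (W : lmodType k) (f : U -> V -> W).

Definition free_lift (x : free) : W := \sum_(p <- msupp x) x@_p *: f p.1 p.2.

(* The linear map on the tensor product induced by f; it is meaningful only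
   for a bilinear f. *)
Definition tlift (t : tensor) : W := free_lift (lquot_repr t).

Lemma free_lift_linear : linear free_lift.
Proof.
have E (d : {fset (U * V)%type}) (x : free) : (msupp x `<=` d)%fset ->
    free_lift x = \sum_(p <- d) x@_p *: f p.1 p.2.
  move=> le; rewrite /free_lift [LHS](big_fset_incl _ le) //= => p _.
  by move/mcoeff_outdom->; rewrite scale0r.
move=> a x y; set d := (msupp x `|` msupp y `|` msupp (a *: x + y))%fset.
rewrite !(E d); try by apply/fsubsetP=> p Hp; rewrite !inE Hp ?orbT.
rewrite scaler_sumr -big_split /=; apply: eq_bigr => p _.
by rewrite mcoeffD mcoeffZ scalerDl scalerA.
Qed.

HB.instance Definition _ := GRing.isLinear.Build k free W _ free_lift
  free_lift_linear.

Lemma free_liftU u v : free_lift << (u, v) >> = f u v.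
Proof. by rewrite /free_lift msuppU oner_eq0 big_seq_fset1 mcoeffUU scale1r. Qed.

Hypothesis fB : bilin f.

Lemma free_lift_lspan x : x \in lspan tensor_rel -> free_lift x = 0.
Proof.
apply: (lspan_ind (Q := fun x => free_lift x = 0))
  => [|_ [a u u' v|a u v v']|a y z y0 z0].
- exact: linear0.
- by rewrite linearB linearP /= !free_liftU (fB.1 v) subrr.
- by rewrite linearB linearP /= !free_liftU (fB.2 u) subrr.
- by rewrite linearP /= y0 z0 scaler0 addr0.
Qed.

Lemma tlift_pi x : tlift (lquot_pi tensor_rel x) = free_lift x.
Proof.
apply/eqP; rewrite -subr_eq0 -linearB; apply/eqP/free_lift_lspan.
exact: lquot_reprP.
Qed.

Lemma tliftE u v : tlift (tpure u v) = f u v.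
Proof. by rewrite tlift_pi free_liftU. Qed.

Lemma tlift_linear : linear tlift.
Proof.
move=> a x y; rewrite -[x]lquot_reprK -[y]lquot_reprK.
by rewrite -[_ + _ in LHS]linearP !tlift_pi linearP.
Qed.

End Lift.

Lemma tensor_ind (Q : tensor -> Prop) :
  Q 0 -> (forall u v t, Q t -> Q (tpure u v + t)) -> forall t, Q t.
Proof.
move=> Q0 QD t; rewrite -[t]lquot_reprK [lquot_repr t]monalgE.
elim: (X in \sum_(p <- X) _) => [|p s IHs]; first by rewrite big_nil linear0.
rewrite big_cons lquot_piD; set c := _@_p; case: p @c => u v c.
have -> : lquot_pi tensor_rel << c *g (u, v) >> = tpure (c *: u) v.
  rewrite (_ : << c *g _ >> = c *: << (u, v) >>); last first.
    by apply/malgP=> q; rewrite mcoeffZ !mcoeffU mulrnAr mulr1.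
  rewrite linearZ -[c *: u]addr0 tpure_linearl -[LHS]addr0; congr (_ + _).
  by rewrite -[RHS](addKr (tpure 0 v)) -{2}[tpure 0 v]scale1r
       -tpure_linearl scale1r addr0 addNr.
exact: QD.
Qed.

Lemma tensor_ext (W : lmodType k) (f g : tensor -> W) :
  linear f -> linear g -> (forall u v, f (tpure u v) = g (tpure u v)) ->
  f =1 g.
Proof.
move=> fL gL fg; have L0 (h : tensor -> W) : linear h -> h 0 = 0.
  by move=> hL; rewrite -[0 in LHS](addNr 0) -[- 0]scaleN1r hL scaleN1r addNr.
elim/tensor_ind => [|u v t IHt]; first by rewrite !L0.
by rewrite -[_ ⊗ _]scale1r fL gL IHt fg.
Qed.

Lemma eq_tlift (W : lmodType k) (f g : U -> V -> W) :
  (forall u v, f u v = g u v) -> tlift f =1 tlift g.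
Proof. by move=> fg t; apply: eq_bigr => p _; rewrite fg. Qed.

Lemma tlift_comb (W : lmodType k) (f g : U -> V -> W) a t :
  tlift (fun u v => a *: f u v + g u v) t = a *: tlift f t + tlift g t.
Proof.
rewrite /tlift /free_lift scaler_sumr -big_split /=; apply: eq_bigr => p _.
by rewrite scalerDr !scalerA mulrC.
Qed.

End Tensor.

Arguments tensor {k} (U V)%_type_scope.

Notation "U ⊗ V" := (tensor U V) (at level 40, left associativity) : type_scope.
Notation "u ⊗ v" := (tpure u v) (at level 40, left associativity) : ring_scope.

Section TensorMaps.
Variable k : fieldType.

Definition tmap (U U' V V' : lmodType k) (f : {linear U -> U'})
  (g : {linear V -> V'}) : U ⊗ V -> U' ⊗ V' := tlift (fun u v => f u ⊗ g v).

Definition tassoc (U V W : lmodType k) : (U ⊗ V) ⊗ W -> U ⊗ (V ⊗ W) :=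
  tlift (fun t w => tlift (fun u v => u ⊗ (v ⊗ w)) t).

End TensorMaps.

(* Only a pzRingType: 1 ⊗ 1 != 0 is not needed below, and its proof would
   require extending linear forms. *)
Section TensorRing.
Variables (k : fieldType) (A B : algType k).
Implicit Types (x y z : A ⊗ B).

Definition tmul_pure (a : A) (b : B) : A ⊗ B -> A ⊗ B :=
  tlift (fun a' b' => (a * a') ⊗ (b * b')).

Definition tmul x y : A ⊗ B := tlift (fun a b => tmul_pure a b y) x.

Fact tmul_pure_bilin (a : A) (b : B) :
  bilin (fun a' b' => (a * a') ⊗ (b * b')).
Proof.
split=> [b'|a'] c s t; first by rewrite mulrDr -scalerAr tpure_linearl.
by rewrite mulrDr -scalerAr tpure_linearr.
Qed.

Fact tmul_pure_linear (a : A) (b : B) : linear (tmul_pure a b).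
Proof. exact: tlift_linear (tmul_pure_bilin a b). Qed.

Fact tmul_bilin y : bilin (fun a b => tmul_pure a b y).
Proof.
split=> [b|a] c s t; rewrite -tlift_comb; apply: eq_tlift => a' b'.
  by rewrite mulrDl -scalerAl tpure_linearl.
by rewrite mulrDl -scalerAl tpure_linearr.
Qed.

Fact tmul_linearl y : linear (tmul^~ y).
Proof. exact: tlift_linear (tmul_bilin y). Qed.

Fact tmul_linearr x : linear (tmul x).
Proof.
move=> c y z; apply: etrans (tlift_comb _ _ _ _); apply: eq_tlift => a b.
exact: tmul_pure_linear.
Qed.

Lemma tmulE a b a' b' : tmul (a ⊗ b) (a' ⊗ b') = (a * a') ⊗ (b * b').
Proof.
by rewrite /tmul (tliftE (tmul_bilin _)) /tmul_pure
     (tliftE (tmul_pure_bilin _ _)).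
Qed.

Fact tmulA : associative tmul.
Proof.
move=> x y z; move: x; apply: tensor_ext => [||a b].
- exact: tmul_linearl.
- by move=> c s t; rewrite !tmul_linearl.
move: y; apply: tensor_ext => [||a' b'].
- by move=> c s t; rewrite tmul_linearl tmul_linearr.
- by move=> c s t; rewrite tmul_linearr tmul_linearl.
move: z; apply: tensor_ext => [||a'' b''].
- by move=> c s t; rewrite !tmul_linearr.
- exact: tmul_linearr.
by rewrite !tmulE !mulrA.
Qed.

Fact tmul1l : left_id (1 ⊗ 1) tmul.
Proof.
apply: tensor_ext => [||a b]; [exact: tmul_linearr | by [] |].
by rewrite tmulE !mul1r.
Qed.

Fact tmul1r : right_id (1 ⊗ 1) tmul.
Proof.
apply: tensor_ext => [||a b]; [exact: tmul_linearl | by [] |].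
by rewrite tmulE !mulr1.
Qed.

Fact tmulDl : left_distributive tmul +%R.
Proof. by move=> x y z; rewrite -[x]scale1r tmul_linearl !scale1r. Qed.

Fact tmulDr : right_distributive tmul +%R.
Proof. by move=> x y z; rewrite -[y]scale1r tmul_linearr !scale1r. Qed.

HB.instance Definition _ := GRing.Zmodule_isPzRing.Build (tensor A B)
  tmulA tmul1l tmul1r tmulDl tmulDr.

End TensorRing.

Section HopfAlgebras.
Variable k : fieldType.

Record hopf (A : algType k) := Hopf {
  comul : {linear A -> (A ⊗ A)%type};
  counit : {lrmorphism A -> k^o};
  antipode : {linear A -> A};
  comul_monoid_morphism : monoid_morphism comul;
  comulA : forall x,
    tassoc (tmap comul idfun (comul x)) = tmap idfun comul (comul x);
  counitl : forall x, tlift (fun a b => counit a *: b) (comul x) = x;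
  counitr : forall x, tlift (fun a b => counit b *: a) (comul x) = x;
  antipodel : forall x,
    tlift (fun a b => antipode a * b) (comul x) = (counit x)%:A;
  antipoder : forall x,
    tlift (fun a b => a * antipode b) (comul x) = (counit x)%:A
}.

Record hopf_morphism (A B : algType k) (hA : hopf A) (hB : hopf B)
    (f : {lrmorphism A -> B}) : Prop := HopfMorphism {
  hopf_morph_comul : forall x, comul hB (f x) = tmap f f (comul hA x);
  hopf_morph_counit : forall x, counit hB (f x) = counit hA x;
  hopf_morph_antipode : forall x, antipode hB (f x) = f (antipode hA x)
}.

Record bijhopf (A : algType k) := BijHopf {
  bijhopf_hopf :> hopf A;
  antipode_inv : A -> A;
  antipodeK : cancel (antipode bijhopf_hopf) antipode_inv;
  antipode_invK : cancel antipode_inv (antipode bijhopf_hopf)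
}.

(* f * g : x |-> f(x_(1)) g(x_(2)) *)
Definition convolution (A B : algType k) (hA : hopf A) (f g : A -> B) (x : A)
  : B := tlift (fun a b => f a * g b) (comul hA x).

Definition convolution_inverse (A : algType k) (hA : hopf A) (f g : A -> k^o) :
    Prop :=
  convolution hA f g =1 counit hA /\ convolution hA g f =1 counit hA.

(* In S^-1 = Phi * S * Phi^-1, linear forms are composed with the unit map
   k -> A. *)
Definition sovereign (A : algType k) (hA : bijhopf A)
    (Phi : {lrmorphism A -> k^o}) : Prop :=
  exists2 Psi : {linear A -> k^o}, convolution_inverse hA Phi Psi &
    antipode_inv hA =1
      convolution hA
        (convolution hA (fun x => (Phi x)%:A) (antipode hA))
        (fun x => (Psi x)%:A).

Record cosovereign (A : algType k) := Cosovereign {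
  cosovereign_hopf :> bijhopf A;
  sovereign_character : {lrmorphism A -> k^o};
  sovereign_characterP : sovereign cosovereign_hopf sovereign_character
}.

Inductive in_subalgebra (A : algType k) (s : seq A) : A -> Prop :=
| in_subalgebra_gen x : x \in s -> in_subalgebra s x
| in_subalgebra1 : in_subalgebra s 1
| in_subalgebraDZ a x y :
    in_subalgebra s x -> in_subalgebra s y -> in_subalgebra s (a *: x + y)
| in_subalgebraM x y :
    in_subalgebra s x -> in_subalgebra s y -> in_subalgebra s (x * y).

Definition finite_type (A : algType k) : Prop :=
  exists s : seq A, forall x, in_subalgebra s x.

End HopfAlgebras.

Section Comodules.
Variables (k : fieldType) (A : algType k).

Record coaction (hA : hopf A) (V : lmodType k)
    (alpha : {linear V -> (V ⊗ A)%type}) : Prop := Coaction {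
  coactionA : forall v,
    tassoc (tmap alpha idfun (alpha v)) = tmap idfun (comul hA) (alpha v);
  coaction1 : forall v, tlift (fun w a => counit hA a *: w) (alpha v) = v
}.

Definition comodule_iso (V W : lmodType k) (alpha : V -> V ⊗ A)
    (beta : W -> W ⊗ A) : Prop :=
  exists2 f : {linear V -> W}, bijective f &
    forall v, beta (f v) = tmap f idfun (alpha v).

Section Duals.
Variables (V : vectType k) (n : nat) (e : n.-tuple V).
Local Notation dual := 'Hom(V, k^o).

(* The matrix a with alpha (e_i) = \sum_j e_j ⊗ a_ji, for a basis e. *)
Definition coaction_mx (alpha : V -> V ⊗ A) : 'M[A]_n :=
  \matrix_(j, i) tlift (fun v x => coord e j v *: x) (alpha e`_i).

Definition dual_basis (i : 'I_n) : dual := linfun (coord e i : V -> k^o).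

(* The linear map with e_i^* |-> \sum_j e_j^* ⊗ T (a_ij). *)
Definition dual_coaction (T : A -> A) (alpha : V -> V ⊗ A) (f : dual)
  : dual ⊗ A :=
  \sum_(i < n) f e`_i *: \sum_(j < n) dual_basis j ⊗ T (coaction_mx alpha i j).

Definition left_dual (hA : hopf A) := dual_coaction (antipode hA).
Definition right_dual (hA : bijhopf A) := dual_coaction (antipode_inv hA).

End Duals.
End Comodules.

(* The free algebra on X is the monoid algebra of the free monoid on X. *)
Section FreeAlgebra.
Variables (k : fieldType) (X : choiceType).

Fact fmalg_scalerAr (a : k) (x y : {malg k[{fmonom X}]}) :
  a *: (x * y) = x * (a *: y).
Proof.
have comC : a%:MP * x = x * a%:MP.
  rewrite !malgM_def fgmulUg fgmulgU; apply: eq_bigr => m _.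
  by rewrite mul1m mulm1 mulrC.
have mulCA (R : nzRingType) (c u v : R) :
    c * u = u * c -> c * (u * v) = u * (c * v).
  by rewrite !mulrA => ->.
rewrite -[LHS]mul_malgC; apply: etrans (mulCA _ _ _ _ comC) _.
exact: congr1 (mul_malgC a y).
Qed.

Definition freealg : Type := {malg k[{fmonom X}]}.
HB.instance Definition _ := GRing.Lalgebra.on freealg.

HB.instance Definition _ := GRing.Lalgebra_isAlgebra.Build k freealg
  fmalg_scalerAr.

Definition freealg_gen (x : X) : freealg := << fmu x >>.

Section Eval.
Variables (B : algType k) (f : X -> B).

Definition fmonom_eval (m : {fmonom X}) : B := \prod_(x <- (m : seq X)) f x.

Fact fmonom_eval_mmorphism : mmorphism fmonom_eval.
Proof.
split=> [m1 m2|]; rewrite /fmonom_eval.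
  by rewrite fmM big_cat.
by rewrite fm1 big_nil.
Qed.

HB.instance Definition _ := isMultiplicative.Build _ B fmonom_eval
  fmonom_eval_mmorphism.

Definition freealg_eval (x : freealg) : B := mmap (in_alg B) fmonom_eval x.

Fact freealg_eval_linear : linear freealg_eval.
Proof.
move=> a x y; rewrite /freealg_eval mmapD mmapZ.
by rewrite -[_ * mmap _ _ x]scalerAl mul1r.
Qed.

HB.instance Definition _ := GRing.isLinear.Build k freealg B _ freealg_eval
  freealg_eval_linear.

Fact freealg_eval_monoid_morphism : monoid_morphism freealg_eval.
Proof.
have [|M1 M2] := @commr_mmap_is_multiplicative {fmonom X} k B (in_alg B)
  fmonom_eval.
  by move=> g m m'; rewrite /GRing.comm -[LHS]scalerAl -[RHS]scalerAr mul1r mulr1.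
by split.
Qed.

HB.instance Definition _ := GRing.isMonoidMorphism.Build freealg B freealg_eval
  freealg_eval_monoid_morphism.

Lemma freealg_evalE x : freealg_eval (freealg_gen x) = f x.
Proof.
rewrite /freealg_eval mmapU -[LHS]scalerAl scale1r mul1r /fmonom_eval fmU.
by rewrite big_seq1.
Qed.

End Eval.

Lemma freealg_ext (B : algType k) (f g : {lrmorphism freealg -> B}) :
  (forall x, f (freealg_gen x) = g (freealg_gen x)) -> f =1 g.
Proof.
move=> fg; have fgm (m : {fmonom X}) : f (<< m >> : freealg) = g << m >>.
  case: m; elim=> [|x s IHs].
    have -> : << FMonom [::] >> = 1 :> freealg by rewrite -fmoneE.
    by rewrite !rmorph1.
  have -> : << FMonom (x :: s) >> = freealg_gen x * << FMonom s >> :> freealg.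
    rewrite [RHS]fgmulUU mulr1; congr (<< 1 *g _ >>).
    by apply/val_inj; rewrite /= fmM fmU.
  by rewrite !rmorphM /= fg IHs.
move=> x; rewrite [x]monalgE !raddf_sum; apply: eq_bigr => m _.
have -> : << x@_m *g m >> = x@_m *: << m >> :> freealg.
  apply/malgP=> m'; rewrite [RHS]mcoeffZ !mcoeffU.
  by rewrite mulrnAr mulr1.
apply: etrans (linearZ_LR f _ _) _; apply: etrans (esym (linearZ_LR g _ _)).
by congr (_ *: _); exact: fgm.
Qed.

End FreeAlgebra.

Definition glmx (k : fieldType) (n : nat) : Type :=
  {F : 'M[k]_n | F \in unitmx}.

Definition glmx_val (k : fieldType) (n : nat) (F : glmx k n) : 'M[k]_n := val F.
Coercion glmx_val : glmx >-> matrix.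

Definition amx (k : fieldType) (n : nat) (A : algType k) (M : 'M[k]_n) :
  'M[A]_n := map_mx (in_alg A) M.

Section MapMatrices.
Variables (k : fieldType) (n : nat) (A B : algType k) (f : {lrmorphism A -> B}).
Implicit Types (u v : 'M[A]_n) (M N : 'M[k]_n).

Lemma map_amx M : map_mx f (amx A M) = amx B M.
Proof. by apply/matrixP=> i j; rewrite !mxE linearZ_LR rmorph1. Qed.

Lemma map_uvT u v : map_mx f (u *m v^T) = map_mx f u *m (map_mx f v)^T.
Proof. by rewrite map_mxM map_trmx. Qed.

Lemma map_vTu u v : map_mx f (v^T *m u) = (map_mx f v)^T *m map_mx f u.
Proof. by rewrite map_mxM map_trmx. Qed.

Lemma map_vMuTN u v M N :
  map_mx f (v *m amx A M *m u^T *m amx A N) =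
  map_mx f v *m amx B M *m (map_mx f u)^T *m amx B N.
Proof. by rewrite !map_mxM !map_amx map_trmx. Qed.

Lemma map_MuTNv u v M N :
  map_mx f (amx A M *m u^T *m amx A N *m v) =
  amx B M *m (map_mx f u)^T *m amx B N *m map_mx f v.
Proof. by rewrite !map_mxM !map_amx map_trmx. Qed.

End MapMatrices.

Section HF.
Variables (k : fieldType) (n : nat) (F : glmx k n).

Local Notation gens := ('I_n * 'I_n + 'I_n * 'I_n)%type.
Local Notation free := (freealg k gens).

Definition free_u : 'M[free]_n := \matrix_(i, j) freealg_gen k (inl (i, j) : gens).
Definition free_v : 'M[free]_n := \matrix_(i, j) freealg_gen k (inr (i, j) : gens).

Local Notation fu := free_u.
Local Notation fv := free_v.

Inductive HF_rel : free -> Prop :=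
| HF_rel_uvT i j : HF_rel ((fu *m fv^T - 1%:M) i j)
| HF_rel_vTu i j : HF_rel ((fv^T *m fu - 1%:M) i j)
| HF_rel_vFuTFV i j :
    HF_rel ((fv *m amx _ F *m fu^T *m amx _ (invmx F) - 1%:M) i j)
| HF_rel_FuTFVv i j :
    HF_rel ((amx _ F *m fu^T *m amx _ (invmx F) *m fv - 1%:M) i j).

Section Eval.
Variables (B : algType k) (U V : 'M[B]_n).

Definition HF_relations : Prop :=
  [/\ U *m V^T = 1%:M, V^T *m U = 1%:M,
      V *m amx _ F *m U^T *m amx _ (invmx F) = 1%:M &
      amx _ F *m U^T *m amx _ (invmx F) *m V = 1%:M].

Definition HF_eval0 : free -> B :=
  freealg_eval (fun g => match g with inl p => U p.1 p.2 | inr p => V p.1 p.2 end).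

HB.instance Definition _ := GRing.LRMorphism.on HF_eval0.

Hypothesis UV : HF_relations.

Lemma HF_eval0_ideal x : x \in lspan (ideal_gens HF_rel) -> HF_eval0 x = 0.
Proof.
have Eu : map_mx HF_eval0 fu = U.
  by apply/matrixP=> i j; rewrite !mxE [LHS]freealg_evalE.
have Ev : map_mx HF_eval0 fv = V.
  by apply/matrixP=> i j; rewrite !mxE [LHS]freealg_evalE.
have E0 (M : 'M[free]_n) : map_mx HF_eval0 M = 1%:M ->
    forall i j, HF_eval0 ((M - 1%:M) i j) = 0.
  move=> M1 i j; have := congr1 (fun N : 'M[B]_n => N i j) M1.
  by rewrite !mxE rmorphB /= => ->; rewrite rmorph_nat subrr.
case: UV => R1 R2 R3 R4.
have Er r : HF_rel r -> HF_eval0 r = 0.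
  case=> i j; apply: E0.
  - by apply: etrans (map_uvT HF_eval0 _ _) _; rewrite Eu Ev.
  - by apply: etrans (map_vTu HF_eval0 _ _) _; rewrite Eu Ev.
  - by apply: etrans (map_vMuTN HF_eval0 _ _ _ _) _; rewrite Eu Ev.
  - by apply: etrans (map_MuTNv HF_eval0 _ _ _ _) _; rewrite Eu Ev.
apply: (lspan_ind (Q := fun x => HF_eval0 x = 0))
  => [|_ [a [b [r [Rr ->]]]]|a y z y0 z0].
- exact: rmorph0.
- by rewrite !rmorphM /= (Er r) // mulr0 mul0r.
- by rewrite linearP /= y0 z0 scaler0 addr0.
Qed.

End Eval.

Fact HF_ideal_proper : 1 \notin lspan (ideal_gens HF_rel).
Proof.
apply/negP=> /(@HF_eval0_ideal k^o 1%:M 1%:M) E.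
suff /E/eqP : HF_relations (1%:M : 'M[k^o]_n) 1%:M.
  by rewrite rmorph1 oner_eq0.
have amxE (M : 'M[k]_n) : amx k^o M = M.
  by apply/matrixP=> i j; rewrite !mxE /= [LHS]mulr1.
rewrite /HF_relations !amxE trmx1 !mul1mx !mulmx1.
by split=> //; apply: (mulmxV (valP F)).
Qed.

(* H(F): noncommutative polynomials in the u_ij (inl) and v_ij (inr), modulo the
   ideal generated by the entries of the defining matrix equations. It has the
   expected universal property, see [HF_uvP], [HF_eval] and [HF_ext]. *)
Definition HF : Type := aquot HF_ideal_proper.
HB.instance Definition _ := GRing.Algebra.on HF.

Definition HF_pi : free -> HF := aquot_pi HF_ideal_proper.
HB.instance Definition _ := GRing.LRMorphism.on HF_pi.

Definition HF_repr : HF -> free := @aquot_repr _ _ _ HF_ideal_proper.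

Lemma HF_reprK : cancel HF_repr HF_pi.
Proof. exact: aquot_reprK. Qed.

Definition HF_u : 'M[HF]_n := map_mx HF_pi fu.
Definition HF_v : 'M[HF]_n := map_mx HF_pi fv.

Lemma HF_uvP : HF_relations HF_u HF_v.
Proof.
have E0 (M : 'M[free]_n) : (forall i j, HF_rel ((M - 1%:M) i j)) ->
    map_mx HF_pi M = 1%:M.
  move=> HM; apply/matrixP=> i j; rewrite !mxE.
  rewrite -(rmorph_nat HF_pi); apply/aquot_piP/lspan_gen.
  exists 1, 1, ((M - 1%:M) i j); split; first exact: HM.
  by rewrite mulr1 mul1r !mxE.
split.
- by apply: etrans (esym (map_uvT HF_pi _ _)) _; apply/E0/HF_rel_uvT.
- by apply: etrans (esym (map_vTu HF_pi _ _)) _; apply/E0/HF_rel_vTu.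
- by apply: etrans (esym (map_vMuTN HF_pi _ _ _ _)) _; apply/E0/HF_rel_vFuTFV.
- by apply: etrans (esym (map_MuTNv HF_pi _ _ _ _)) _; apply/E0/HF_rel_FuTFVv.
Qed.

Section UniversalProperty.
Variables (B : algType k) (U V : 'M[B]_n) (UV : HF_relations U V).

Definition HF_eval of HF_relations U V : HF -> B :=
  fun x => HF_eval0 U V (HF_repr x).

Lemma HF_eval_pi x : HF_eval UV (HF_pi x) = HF_eval0 U V x.
Proof.
apply/eqP; rewrite -subr_eq0 -rmorphB; apply/eqP/(HF_eval0_ideal UV).
exact: lquot_reprP.
Qed.

Fact HF_eval_linear : linear (HF_eval UV).
Proof.
move=> a x y; rewrite -[x]HF_reprK -[y]HF_reprK -[_ + _]linearP.
by rewrite !HF_eval_pi linearP.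
Qed.

HB.instance Definition _ := GRing.isLinear.Build k HF B _ (HF_eval UV)
  HF_eval_linear.

Fact HF_eval_monoid_morphism : monoid_morphism (HF_eval UV).
Proof.
split=> [|x y]; first by rewrite [LHS]HF_eval_pi rmorph1.
rewrite -[x]HF_reprK -[y]HF_reprK -[_ * _]rmorphM.
by rewrite !HF_eval_pi rmorphM.
Qed.

HB.instance Definition _ := GRing.isMonoidMorphism.Build HF B (HF_eval UV)
  HF_eval_monoid_morphism.

Lemma HF_eval_u : map_mx (HF_eval UV) HF_u = U.
Proof. by apply/matrixP=> i j; rewrite !mxE HF_eval_pi [LHS]freealg_evalE. Qed.

Lemma HF_eval_v : map_mx (HF_eval UV) HF_v = V.
Proof. by apply/matrixP=> i j; rewrite !mxE HF_eval_pi [LHS]freealg_evalE. Qed.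

End UniversalProperty.

Lemma HF_ext (B : algType k) (f g : {lrmorphism HF -> B}) :
  map_mx f HF_u = map_mx g HF_u -> map_mx f HF_v = map_mx g HF_v -> f =1 g.
Proof.
move=> fgu fgv x; rewrite -[x]HF_reprK.
have fgE y : (f \o HF_pi) y = (g \o HF_pi) y.
  apply: freealg_ext => -[] [i j] /=.
    by have := congr1 (fun M : 'M[B]_n => M i j) fgu; rewrite !mxE.
  by have := congr1 (fun M : 'M[B]_n => M i j) fgv; rewrite !mxE.
exact: fgE.
Qed.

End HF.

(* Main.v *)
(* Call a family [a] of elements of a Hopf algebra multiplicative when
   [Δ a_ij = Σ_l a_il ⊗ a_lj] and [ε a_ij = δ_ij]; then [S a] is the inverse
   matrix of [a]. Every element is a combination of entries of multiplicative
   families, and Kronecker products of such families are multiplicative, so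
   uniqueness of inverse matrices yields that [S] is anti-multiplicative, that it
   is anti-comultiplicative, and that bialgebra morphisms preserve it. The same
   principle reduces the Hopf axioms of [HF F] to the families [u] and [v].
   If [a] is multiplicative in [A] and [M] is an invertible scalar matrix with
   [S(a)^T M = M S^-1(a)^T], then [u |-> a, v |-> S(a)^T] satisfies the relations
   of [HF M]. An isomorphism from the right to the left dual of a comodule
   provides such an [M], and a sovereign character [Phi] provides
   [M = Phi(a)^T]. *)
Require Import Defs.
From HB Require Import structures.
From mathcomp Require Import all_boot all_algebra.
From mathcomp Require Import boolp.
From mathcomp Require classical_sets.
From mathcomp.multinomials Require Import monalg.

Set Implicit Arguments.
Unset Strict Implicit.
Unset Printing Implicit Defensive.

Import GRing.Theory.

Local Open Scope ring_scope.

(** * Tensor products *)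

(** The relations of [HF F] say that the square of the antipode is conjugation by a scalar matrix:
    from [S u = v^T] and [S v = F u^T F^-1] one gets [S^2 u = F^-T u F^T]. This is why
    [S(a)^T M = M S^-1(a)^T] is the condition to look for in a target Hopf algebra. The map x |->
    S(x_(1)) x_(2) is not an algebra morphism, so the antipode axiom cannot be transferred from the
    generators by the universal property; it is linear, which is why spanning families are used. The
    universal property only yields algebra morphisms into an [algType], which is a nonzero algebra.
    The antipode and its inverse are therefore built as morphisms into the opposite algebra, and the
    comultiplication needs [H ⊗ H] to be nonzero, so the counit is constructed before it.
    Independence arguments take place in spaces of arbitrary dimension; the linear forms that they
    need come from Zorn's lemma. *)

Section LinearFunctions.
Variables (k : pzRingType) (U V : lmodType k) (h : U -> V).
Hypothesis hL : linear h.

(** Stated for bare functions with a proof of linearity: a map such as [tlift f] is linear only for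
    a bilinear [f], so it carries no canonical linear structure. *)
Lemma lin0 : h 0 = 0.
Proof. by rewrite -[0 in LHS](addNr 0) -[- 0]scaleN1r hL scaleN1r addNr. Qed.

Lemma linD x y : h (x + y) = h x + h y.
Proof. by rewrite -[x]scale1r hL !scale1r. Qed.

Lemma linZ a x : h (a *: x) = a *: h x.
Proof. by rewrite -[_ *: _ in LHS]addr0 hL lin0 addr0. Qed.

Lemma lin_sum (I : Type) (r : seq I) (P : pred I) (F : I -> U) :
  h (\sum_(i <- r | P i) F i) = \sum_(i <- r | P i) h (F i).
Proof. exact: (big_morph h linD lin0). Qed.

End LinearFunctions.

Lemma scale_linear (k : comPzRingType) (V : lmodType k) (a : k) :
  linear (fun x : V => a *: x).
Proof. by move=> b x y; rewrite scalerDr !scalerA [a * b]mulrC. Qed.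

Lemma lin_comp (k : pzRingType) (U V W : lmodType k) (g : V -> W) (f : U -> V) :
  linear g -> linear f -> linear (fun x => g (f x)).
Proof. by move=> gL fL a x y; rewrite fL gL. Qed.

Section TensorTheory.
Variables (k : fieldType) (U V : lmodType k).

Lemma tpureDl (u u' : U) (v : V) : (u + u') ⊗ v = u ⊗ v + u' ⊗ v.
Proof. exact: (linD (tpure_linearl v)). Qed.

Lemma tpureDr (u : U) (v v' : V) : u ⊗ (v + v') = u ⊗ v + u ⊗ v'.
Proof. exact: (linD (tpure_linearr u)). Qed.

Lemma tpureZl a (u : U) (v : V) : (a *: u) ⊗ v = a *: (u ⊗ v).
Proof. exact: (linZ (tpure_linearl v)). Qed.

Lemma tpureZr a (u : U) (v : V) : u ⊗ (a *: v) = a *: (u ⊗ v).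
Proof. exact: (linZ (tpure_linearr u)). Qed.

Lemma tpure0l (v : V) : (0 : U) ⊗ v = 0.
Proof. exact: (lin0 (tpure_linearl v)). Qed.

Lemma tpure0r (u : U) : u ⊗ (0 : V) = 0.
Proof. exact: (lin0 (tpure_linearr u)). Qed.

Lemma tpure_suml (I : Type) (r : seq I) (P : pred I) (F : I -> U) (v : V) :
  (\sum_(i <- r | P i) F i) ⊗ v = \sum_(i <- r | P i) F i ⊗ v.
Proof. exact: (lin_sum (tpure_linearl v)). Qed.

Lemma tpure_sumr (I : Type) (r : seq I) (P : pred I) (F : I -> V) (u : U) :
  u ⊗ (\sum_(i <- r | P i) F i) = \sum_(i <- r | P i) u ⊗ F i.
Proof. exact: (lin_sum (tpure_linearr u)). Qed.

Lemma tlift_sum (W : lmodType k) (f : U -> V -> W) (I : finType)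
    (x : I -> U) (y : I -> V) : bilin f ->
  tlift f (\sum_i x i ⊗ y i) = \sum_i f (x i) (y i).
Proof.
move=> fB; rewrite (lin_sum (tlift_linear fB)).
by apply: eq_bigr => i _; rewrite tliftE.
Qed.

Lemma tensor_pure_sum (t : (U ⊗ V)%type) :
  exists n (x : 'I_n -> U) (y : 'I_n -> V), t = \sum_i x i ⊗ y i.
Proof.
elim/tensor_ind: t => [|u v t [n [x [y ->]]]].
  by exists 0%N, (fun=> 0), (fun=> 0); rewrite big_ord0.
exists n.+1, (fun i => oapp x u (unlift ord0 i)),
  (fun i => oapp y v (unlift ord0 i)).
rewrite big_ord_recl unlift_none; congr (_ + _).
by apply: eq_bigr => i _; rewrite liftK.
Qed.

End TensorTheory.

Section TensorMapTheory.
Variables (k : fieldType) (U U' V V' W : lmodType k).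

Lemma tmap_bilin (f : {linear U -> U'}) (g : {linear V -> V'}) :
  bilin (fun u v => f u ⊗ g v).
Proof.
split=> [v|u] a x y; first by rewrite linearP tpure_linearl.
by rewrite linearP tpure_linearr.
Qed.

Lemma tmapE (f : {linear U -> U'}) (g : {linear V -> V'}) u v :
  tmap f g (u ⊗ v) = f u ⊗ g v.
Proof. exact/tliftE/tmap_bilin. Qed.

Lemma tmap_linear (f : {linear U -> U'}) (g : {linear V -> V'}) :
  linear (tmap f g).
Proof. exact/tlift_linear/tmap_bilin. Qed.

Lemma tmap_sum (f : {linear U -> U'}) (g : {linear V -> V'}) (I : finType)
    (x : I -> U) (y : I -> V) :
  tmap f g (\sum_i x i ⊗ y i) = \sum_i f (x i) ⊗ g (y i).
Proof. exact/tlift_sum/tmap_bilin. Qed.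

Lemma tassoc_inner_bilin (w : W) : bilin (fun (u : U) (v : V) => u ⊗ (v ⊗ w)).
Proof.
split=> [v|u] a x y; first by rewrite tpure_linearl.
by rewrite tpure_linearl tpure_linearr.
Qed.

Lemma tassoc_bilin :
  bilin (fun (t : (U ⊗ V)%type) (w : W) => tlift (fun u v => u ⊗ (v ⊗ w)) t).
Proof.
split=> [w|t] a x y; first exact/tlift_linear/tassoc_inner_bilin.
rewrite -tlift_comb; apply: eq_tlift => u v.
by rewrite !tpure_linearr.
Qed.

Lemma tassoc_linear : linear (@tassoc k U V W).
Proof. exact/tlift_linear/tassoc_bilin. Qed.

Lemma tassocE (u : U) (v : V) (w : W) : tassoc ((u ⊗ v) ⊗ w) = u ⊗ (v ⊗ w).
Proof.
by rewrite /tassoc (tliftE tassoc_bilin) (tliftE (tassoc_inner_bilin _)).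
Qed.

End TensorMapTheory.

(** * Separating linear forms and tensors of minimal rank *)

Section Separation.
Variables (k : fieldType) (V : lmodType k).

Lemma lspan_sub (P Q : V -> Prop) x :
  (forall y, P y -> y \in lspan Q) -> x \in lspan P -> x \in lspan Q.
Proof.
move=> PQ; apply: (lspan_ind (Q := fun x => x \in _)) => //.
  exact: rpred0.
by move=> a y z Qy Qz; rewrite rpredD ?rpredZ.
Qed.

Lemma lspan_setU1 (P : V -> Prop) x y :
  y \in lspan (fun z => P z \/ z = x) ->
  exists c m, m \in lspan P /\ y = c *: x + m.
Proof.
apply: (lspan_ind (Q := fun y => exists c m, m \in lspan P /\ y = c *: x + m)).
- by exists 0, 0; rewrite rpred0 scale0r addr0.
- move=> z [Pz | ->].
    by exists 0, z; rewrite scale0r add0r; split=> //; exact: lspan_gen.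
  by exists 1, 0; rewrite scale1r addr0 rpred0.
- move=> a _ _ [c [m [Pm ->]]] [d [m' [Pm' ->]]].
  exists (a * c + d), (a *: m + m'); split; first by rewrite rpredD ?rpredZ.
  by rewrite scalerDl scalerDr scalerA addrACA.
Qed.

(* By Zorn there is a maximal subspace that contains P and not v; it is a
   complement of the line spanned by v. *)
Lemma lspan_separation (P : V -> Prop) v : v \notin lspan P ->
  exists phi : {linear V -> k^o}, phi v = 1 /\ (forall x, P x -> phi x = 0).
Proof.
move=> vP.
(* Adjoining [P] inside the property, rather than requiring the sets to contain [P], makes it hold
   for the union of the empty chain. *)
have [|M [vM maxM]] := @classical_sets.Zorn_bigcup V
    (fun X => v \notin lspan (fun z => X z \/ P z)).
  move=> F FP Ftot; apply/negP => vF.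
  (* A combination uses finitely many generators, and the chain is total, so those taken from the
     union lie in a single member; the first alternative is a combination that uses none of them. *)
  have [vP'|[X [FX vX]]] : v \in lspan P \/
      exists X, F X /\ v \in lspan (fun z => X z \/ P z).
    pose Q w := w \in lspan P \/
      exists X, F X /\ w \in lspan (fun z => X z \/ P z).
    move: v vF {vP FP}; apply: (lspan_ind (Q := Q)); rewrite /Q.
    - by left; rewrite rpred0.
    - move=> x [[X FX Xx]|Px]; last by left; exact: lspan_gen.
      by right; exists X; split=> //; apply: lspan_gen; left.
    - move=> a x y; case=> [xP|[X [FX xX]]] [yP|[Y [FY yY]]].
      + by left; rewrite rpredD ?rpredZ.
      + right; exists Y; split=> //; rewrite rpredD ?rpredZ //.
        by apply: lspan_sub xP => z Pz; apply: lspan_gen; right.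
      + right; exists X; split=> //; rewrite rpredD ?rpredZ //.
        by apply: lspan_sub yP => z Pz; apply: lspan_gen; right.
      + right; case: (Ftot X Y FX FY) => XY.
          exists Y; split=> //; rewrite rpredD ?rpredZ //.
          apply: lspan_sub xX => z [/XY Yz|Pz]; apply: lspan_gen; first by left.
          by right.
        exists X; split=> //; rewrite rpredD ?rpredZ //.
        apply: lspan_sub yY => z [/XY Yz|Pz]; apply: lspan_gen; first by left.
        by right.
    by rewrite vP' in vP.
  by have := FP X FX; rewrite vX.
set L := lspan (fun z => M z \/ P z) in vM.
(* If [x] is outside [L], maximality puts [v] in the span of [L] and [x]; the coefficient of [x]
   there is nonzero, and solving for [x] gives the multiple of [v]. *)
have dec x : exists c, x - c *: v \in L.
  have [xL|xL] := boolP (x \in L); first by exists 0; rewrite scale0r subr0.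
  have [|c [m [mL E]]] := @lspan_setU1 (fun z => M z \/ P z) x v.
  - apply: contrapT => nv; apply: (maxM (fun z => M z \/ z = x)).
      split; first by left.
      move=> /(_ x (or_intror erefl)) Mx.
      by move/negP: xL; apply; apply: lspan_gen; left.
    apply/negP => vx; apply: nv; apply: lspan_sub vx => z Hz.
    by apply: lspan_gen; case: Hz => [[]|]; auto.
  have c0 : c != 0.
    by apply: contraNneq vM => c0; rewrite E c0 scale0r add0r.
  exists c^-1; rewrite E scalerDr scalerA mulVf // scale1r opprD addNKr.
  by rewrite rpredN rpredZ.
have [phi phiP] := choice dec.
(* Two different coefficients would put a nonzero multiple of [v] in [L]. Uniqueness turns the
   chosen function into a linear form. *)
have uniq x c : x - c *: v \in L -> phi x = c.
  move=> xc; apply: contraNeq vM; rewrite -subr_eq0 => d0.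
  have : (x - c *: v) - (x - phi x *: v) \in L by rewrite rpredB.
  rewrite opprB addrC addrA subrK -scalerBl.
  by move/(rpredZ (phi x - c)^-1); rewrite scalerA mulVf // scale1r.
have phiL : linear (phi : V -> k^o).
  move=> a x y; apply: uniq.
  rewrite scalerDl opprD addrACA rpredD // -scalerA -scalerBr.
  exact: rpredZ.
pose Phi := GRing.isLinear.Build k V k^o _ phi phiL.
exists (HB.pack (phi : V -> k^o) Phi : {linear V -> k^o}) => /=; split.
  by apply: uniq; rewrite scale1r subrr rpred0.
move=> x Px; apply: uniq; rewrite scale0r subr0.
by apply: lspan_gen; right.
Qed.

Lemma lspan_family (I : finType) (y : I -> V) (Q : pred I) x :
  x \in lspan (fun z => exists2 i, Q i & z = y i) ->
  exists c : I -> k, x = \sum_(i | Q i) c i *: y i.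
Proof.
apply: (lspan_ind (Q := fun x => exists c : I -> k,
  x = \sum_(i | Q i) c i *: y i)).
- by exists (fun=> 0); rewrite big1 // => i _; rewrite scale0r.
- move=> _ [i Qi ->]; exists (fun j => (j == i)%:R).
  rewrite (bigD1 i) //= eqxx scale1r big1 ?addr0 // => j /andP[_ /negPf ->].
  by rewrite scale0r.
- move=> a _ _ [c ->] [d ->]; exists (fun i => a * c i + d i).
  rewrite scaler_sumr -big_split /=; apply: eq_bigr => i _.
  by rewrite scalerDl scalerA.
Qed.

Lemma dual_family (n : nat) (y : 'I_n -> V) :
  (forall i, y i \notin lspan (fun z => exists2 j, j != i & z = y j)) ->
  exists phi : 'I_n -> {linear V -> k^o}, forall i j, phi i (y j) = (i == j)%:R.
Proof.
move=> yI; have /choice[phi phiP] i := lspan_separation (yI i).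
exists phi => i j; have [phi1 phi0] := phiP i.
by have [<-|ij] := eqVneq; rewrite // phi0 //; exists j; rewrite // eq_sym.
Qed.

End Separation.

Section TensorRank.
Variables (k : fieldType) (U V : lmodType k).

(** In a decomposition of least length both families are independent: if one vector is a combination
    of the others, bilinearity absorbs its term into the remaining ones. Separation then provides
    the dual forms. *)
Lemma tensor_min_rank (t : (U ⊗ V)%type) :
  exists n (x : 'I_n -> U) (y : 'I_n -> V)
    (phi : 'I_n -> {linear U -> k^o}) (psi : 'I_n -> {linear V -> k^o}),
  [/\ t = \sum_i x i ⊗ y i, forall i j, phi i (x j) = (i == j)%:R
    & forall i j, psi i (y j) = (i == j)%:R].
Proof.
pose Q n := `[< exists (x : 'I_n -> U) (y : 'I_n -> V), t = \sum_i x i ⊗ y i >].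
have exQ : exists n, Q n.
  by have [n H] := tensor_pure_sum t; exists n; apply/asboolP.
have [n /asboolP [x [y tE]] minn] := ex_minnP exQ.
(* Reindexing along [lift i] gives a decomposition of length [n.-1], which is smaller than [n]
   because ['I_n] is inhabited by [i]. *)
have bad (i : 'I_n) : (exists x' y', t = \sum_(j | j != i) x' j ⊗ y' j) -> False.
  move=> [x' [y' tE']].
  have : Q n.-1.
    apply/asboolP; exists (x' \o lift i), (y' \o lift i); rewrite tE'.
    apply: (addrI (x' i ⊗ y' i)).
    rewrite -(bigD1 i (P := predT) (F := fun j => x' j ⊗ y' j)) //.
    exact: (bigD1_ord i (P := predT)).
  by case: n i {x y x' y' tE tE'} minn => [[]|n i minn /minn] //; rewrite ltnn.
have xI i : x i \notin lspan (fun z => exists2 j, j != i & z = x j).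
  apply/negP => /lspan_family[c xiE]; apply: (bad i).
  exists x, (fun j => y j + c j *: y i).
  rewrite tE (bigD1 i) //= {1}xiE tpure_suml -big_split /=.
  by apply: eq_bigr => j _; rewrite tpureDr tpureZl tpureZr addrC.
have yI i : y i \notin lspan (fun z => exists2 j, j != i & z = y j).
  apply/negP => /lspan_family[c yiE]; apply: (bad i).
  exists (fun j => x j + c j *: x i), y.
  rewrite tE (bigD1 i) //= {1}yiE tpure_sumr -big_split /=.
  by apply: eq_bigr => j _; rewrite tpureDl tpureZl tpureZr addrC.
have [phi phiP] := dual_family xI; have [psi psiP] := dual_family yI.
by exists n, x, y, phi, psi.
Qed.

End TensorRank.

(** * Multiplicative families in Hopf algebras *)

Section DeltaSums.
Variables (R : pzRingType) (I : finType).

Lemma sum_deltar (f : I -> R) j : \sum_l f l * (l == j)%:R = f j.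
Proof.
rewrite (bigD1 j) //= eqxx mulr1 big1 ?addr0 // => i /negPf->.
by rewrite mulr0.
Qed.

Lemma sum_deltal (f : I -> R) i : \sum_l (i == l)%:R * f l = f i.
Proof.
rewrite (bigD1 i) //= eqxx mul1r big1 ?addr0 // => j; rewrite eq_sym => /negPf->.
by rewrite mul0r.
Qed.

Lemma sum_deltaZ (V : lmodType R) (f : I -> V) i :
  \sum_l (i == l)%:R *: f l = f i.
Proof.
rewrite (bigD1 i) //= eqxx scale1r big1 ?addr0 // => j.
by rewrite eq_sym => /negPf->; rewrite scale0r.
Qed.

(** The argument b = b(ac) = (ba)c = c. Families are indexed by an arbitrary finite type, so that
    Kronecker products and block sums need no renumbering. *)
Lemma family_inv_uniq (a b c : I -> I -> R) :
  (forall i j, \sum_l b i l * a l j = (i == j)%:R) ->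
  (forall i j, \sum_l a i l * c l j = (i == j)%:R) ->
  forall i j, b i j = c i j.
Proof.
move=> ba ac i j; rewrite -[LHS](sum_deltar (b i)).
under eq_bigr => l _ do rewrite -ac mulr_sumr.
rewrite exchange_big /= -[RHS](sum_deltal (c^~ j)).
apply: eq_bigr => m _; rewrite -ba mulr_suml.
by apply: eq_bigr => l _; rewrite mulrA.
Qed.

End DeltaSums.

Section TensorProductRing.
Variables (k : fieldType) (A B : algType k).

Lemma tpureM (a a' : A) (b b' : B) :
  (a ⊗ b) * (a' ⊗ b') = (a * a') ⊗ (b * b').
Proof. exact: tmulE. Qed.

Lemma mul_linear_bilin (C : algType k) (f : A -> C) (g : B -> C) :
  linear f -> linear g -> bilin (fun a b => f a * g b).
Proof.
move=> fL gL; split=> [b|a] c x y; first by rewrite fL mulrDl scalerAl.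
by rewrite gL mulrDr scalerAr.
Qed.

End TensorProductRing.

Section Contraction.
Variables (k : fieldType) (V W : lmodType k) (f : {linear V -> k^o}).

Fact contractl_bilin : bilin (fun v (w : W) => f v *: w).
Proof.
split=> [w|v]; last exact: scale_linear.
by move=> c x y; rewrite linearP scalerDl scalerA.
Qed.

Fact contractr_bilin : bilin (fun (w : W) v => f v *: w).
Proof. by case: contractl_bilin. Qed.

Definition contractl (t : (V ⊗ W)%type) : W := tlift (fun v w => f v *: w) t.
Definition contractr (t : (W ⊗ V)%type) : W := tlift (fun w v => f v *: w) t.

Lemma contractl_linear : linear contractl.
Proof. exact: tlift_linear contractl_bilin. Qed.

Lemma contractr_linear : linear contractr.
Proof. exact: tlift_linear contractr_bilin. Qed.

HB.instance Definition _ :=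
  GRing.isLinear.Build k (V ⊗ W)%type W _ contractl contractl_linear.
HB.instance Definition _ :=
  GRing.isLinear.Build k (W ⊗ V)%type W _ contractr contractr_linear.

Lemma contractlE v w : contractl (v ⊗ w) = f v *: w.
Proof. by rewrite /contractl (tliftE contractl_bilin). Qed.

Lemma contractrE w v : contractr (w ⊗ v) = f v *: w.
Proof. by rewrite /contractr (tliftE contractr_bilin). Qed.

Lemma contractl_sum (I : finType) (v : I -> V) (w : I -> W) :
  contractl (\sum_i v i ⊗ w i) = \sum_i f (v i) *: w i.
Proof. by rewrite /contractl (tlift_sum _ _ contractl_bilin). Qed.

Lemma contractr_sum (I : finType) (v : I -> V) (w : I -> W) :
  contractr (\sum_i w i ⊗ v i) = \sum_i f (v i) *: w i.
Proof. by rewrite /contractr (tlift_sum _ _ contractr_bilin). Qed.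

End Contraction.

Lemma tassoc_contractr (k : fieldType) (U V W : lmodType k)
    (f : {linear W -> k^o}) (s : (U ⊗ V)%type) (w : W) :
  tmap idfun (contractr (W := V) f) (tassoc (s ⊗ w)) = f w *: s.
Proof.
move: s; apply: tensor_ext => [||u v].
- apply: lin_comp; first exact: tmap_linear.
  apply: lin_comp; [exact: tassoc_linear | exact: tpure_linearl].
- exact: scale_linear.
- by rewrite tassocE tmapE /= contractrE tpureZr.
Qed.

Section KroneckerInverse.
Variables (R : pzRingType) (I J : finType).
Variables (a a' : I -> I -> R) (b b' : J -> J -> R).
Hypothesis aa' : forall i j, \sum_l a i l * a' l j = (i == j)%:R.
Hypothesis bb' : forall i j, \sum_l b i l * b' l j = (i == j)%:R.

(** The ring is not commutative, so the factors of the inverse come in reverse order: [b b']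
    contracts in the middle, then [a a'] around it. This reversal is the source of the
    anti-multiplicativity of the antipode. *)
Lemma kronecker_inv (p q : I * J) :
  \sum_l (a p.1 l.1 * b p.2 l.2) * (b' l.2 q.2 * a' l.1 q.1) = (p == q)%:R.
Proof.
case: p q => [i j] [i' j'] /=.
rewrite -(pair_bigA _ (fun l m => a i l * b j m * (b' m j' * a' l i'))) /=.
rewrite xpair_eqE -mulnb natrM -aa' mulr_suml.
apply: eq_bigr => l _; rewrite -mulrA mulr_natr -mulr_natl.
rewrite -bb' mulr_suml mulr_sumr.
by apply: eq_bigr => m _; rewrite !mulrA.
Qed.

End KroneckerInverse.

Section MultiplicativeFamilies.
Variables (k : fieldType) (A : algType k).
Variables (Δ : A -> (A ⊗ A)%type) (ε : {lrmorphism A -> k^o}).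

(** The coefficient matrices of comodules. Only [Δ] and [ε] enter, without any axiom, so that the
    notion is available while a Hopf structure is still under construction. *)
Definition multiplicative_family (I : finType) (a : I -> I -> A) : Prop :=
  (forall i j, Δ (a i j) = \sum_l a i l ⊗ a l j) /\
  (forall i j, ε (a i j) = (i == j)%:R).

Lemma multiplicative_family_reindex (I J : finType) (h : J -> I)
    (a : I -> I -> A) : bijective h ->
  multiplicative_family a -> multiplicative_family (fun i j => a (h i) (h j)).
Proof.
move=> hB [aD ae]; split=> i j; last by rewrite ae (inj_eq (bij_inj hB)).
by rewrite aD (reindex h) //; apply: onW_bij.
Qed.

(** The block-diagonal family of a direct sum of comodules; it gathers the families of several
    elements into one. *)
Lemma multiplicative_familyD (I J : finType) (a : I -> I -> A) (b : J -> J -> A) :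
  Δ 0 = 0 ->
  multiplicative_family a -> multiplicative_family b ->
  multiplicative_family (fun p q : (I + J)%type =>
    match p, q with
    | inl i, inl j => a i j | inr i, inr j => b i j | _, _ => 0
    end).
Proof.
move=> D0 [aD ae] [bD be].
split=> [] [i|i] [j|j] /=; rewrite ?D0 ?raddf0 ?big_sumType //=.
- by rewrite [X in _ + X]big1 ?addr0 // => l _; rewrite tpure0l.
- by rewrite !big1 ?addr0 // => l _; rewrite (tpure0l, tpure0r).
- by rewrite !big1 ?addr0 // => l _; rewrite (tpure0l, tpure0r).
- by rewrite [X in X + _]big1 ?add0r // => l _; rewrite tpure0l.
Qed.

Hypothesis Δ_morph : monoid_morphism Δ.

Lemma multiplicative_familyM (I J : finType) (a : I -> I -> A) (b : J -> J -> A) :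
  multiplicative_family a -> multiplicative_family b ->
  multiplicative_family
    (fun p q : (I * J)%type => a p.1 q.1 * b p.2 q.2).
Proof.
move=> [aD ae] [bD be]; split=> [[i i'] [j j']|[i i'] [j j']] /=.
  rewrite Δ_morph.2 aD bD mulr_suml.
  under [LHS]eq_bigr => l _ do rewrite mulr_sumr.
  by rewrite pair_bigA; apply: eq_bigr => -[l m] _; rewrite tpureM.
by rewrite rmorphM /= ae be xpair_eqE -mulnb natrM.
Qed.

Lemma multiplicative_family1 : multiplicative_family (fun _ _ : unit => 1 : A).
Proof.
split=> [[] []|[] []]; last by rewrite rmorph1.
by rewrite Δ_morph.1 (big_pred1 tt) //; case.
Qed.

End MultiplicativeFamilies.

Section HopfAlgebraTheory.
Variables (k : fieldType) (A : algType k) (hA : hopf A).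
Local Notation Δ := (comul hA).
Local Notation ε := (counit hA).
Local Notation S := (antipode hA).
Local Notation multiplicative_family := (multiplicative_family Δ ε).

Let idL : linear (fun x : A => x). Proof. by []. Qed.

Lemma contractl_counit x : contractl ε (Δ x) = x.
Proof. exact: counitl. Qed.

Lemma contractr_counit x : contractr ε (Δ x) = x.
Proof. exact: counitr. Qed.

Lemma antipode_familyl (I : finType) (a : I -> I -> A) :
  multiplicative_family a ->
  forall i j, \sum_l S (a i l) * a l j = (i == j)%:R.
Proof.
move=> [aD ae] i j; have := antipodel hA (a i j).
rewrite aD ae (tlift_sum _ _ (mul_linear_bilin (linearP S) idL)) => ->.
by rewrite scaler_nat.
Qed.

Lemma antipode_familyr (I : finType) (a : I -> I -> A) :
  multiplicative_family a ->
  forall i j, \sum_l a i l * S (a l j) = (i == j)%:R.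
Proof.
move=> [aD ae] i j; have := antipoder hA (a i j).
rewrite aD ae (tlift_sum _ _ (mul_linear_bilin idL (linearP S))) => ->.
by rewrite scaler_nat.
Qed.

(* Write [Δ x = Σ u_i ⊗ y_i] with [n] minimal, so that the [u_i] and the [y_i]
   are independent; applying [id ⊗ id ⊗ y_j^*] to the coassociativity relation
   gives [Δ u_j = Σ_i u_i ⊗ d_ij], so the [u_i] span a subcomodule of [A] that
   contains [x]. *)
Lemma multiplicative_family_span (x : A) :
  exists n (a : 'I_n -> 'I_n -> A) (c : 'I_n -> 'I_n -> k),
    multiplicative_family a /\ x = \sum_i \sum_j c i j *: a i j.
Proof.
have [n [u [y [phi [psi [xD phiP psiP]]]]]] := tensor_min_rank (Δ x).
pose d i j := contractr (psi j) (Δ (y i)).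
have uD j : Δ (u j) = \sum_i u i ⊗ d i j.
  have := congr1 (tmap idfun (contractr (psi j))) (comulA hA x).
  rewrite xD !tmap_sum (lin_sum (@tassoc_linear _ _ _ _)).
  rewrite (lin_sum (tmap_linear _ _)).
  under eq_bigr => i _ do rewrite tassoc_contractr psiP.
  by rewrite sum_deltaZ.
have u_sum j : u j = \sum_i ε (d i j) *: u i.
  by rewrite -[LHS]contractr_counit uD contractr_sum.
(* The counit values are the coefficients in [u_sum], read through [phi l]. The comultiplication
   comes from applying [phi l] to the first factor of coassociativity at [u j]. *)
have d_mult : multiplicative_family d.
  split=> l j; last first.
    have := congr1 (phi l) (u_sum j); rewrite phiP linear_sum.
    under eq_bigr => i _ do rewrite linearZ /= phiP eq_sym.
    by move=> E; exact: esym (etrans E (sum_deltar (R := k) _ _)).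
  have := congr1 (contractl (phi l)) (comulA hA (u j)).
  rewrite uD !tmap_sum contractl_sum.
  under [RHS]eq_bigr => i _ do rewrite phiP.
  rewrite sum_deltaZ => <-.
  rewrite (lin_sum (@tassoc_linear _ _ _ _)) linear_sum.
  apply: eq_bigr => i _; rewrite uD tpure_suml.
  rewrite (lin_sum (@tassoc_linear _ _ _ _)) linear_sum /=.
  under eq_bigr => m _ do rewrite tassocE contractlE phiP.
  by rewrite sum_deltaZ.
(* The two counit axioms give [x = Σ_j ε(y_j) u_j] and [u_j = Σ_i ε(u_i) d_ij]. *)
exists n, d, (fun i j => ε (y j) * ε (u i)); split=> //.
rewrite -[LHS]contractr_counit xD contractr_sum exchange_big /=.
apply: eq_bigr => j _; rewrite -{1}[u j]contractl_counit uD contractl_sum.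
by rewrite scaler_sumr; apply: eq_bigr => i _; rewrite scalerA.
Qed.

Lemma multiplicative_family_ind (P : A -> Prop) :
  P 0 -> (forall c x y, P x -> P y -> P (c *: x + y)) ->
  (forall n (a : 'I_n -> 'I_n -> A), multiplicative_family a ->
     forall i j, P (a i j)) ->
  forall x, P x.
Proof.
move=> P0 PDZ Pa x; have [n [a [c [aM ->]]]] := multiplicative_family_span x.
elim/big_ind: _ => [|y z Py Pz|i _] //.
  by rewrite -[y]scale1r; apply: PDZ.
elim/big_ind: _ => [|y z Py Pz|j _] //.
  by rewrite -[y]scale1r; apply: PDZ.
by rewrite -[_ *: _]addr0; apply: PDZ => //; exact: Pa.
Qed.

(* For multiplicative [a] and [b], both [S (a i j * b l m)] and
   [S (b l m) * S (a i j)] are the inverse of the Kronecker product. *)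
Lemma antipodeM x y : S (x * y) = S y * S x.
Proof.
move: x; apply: multiplicative_family_ind => [|c x x' Hx Hx'|n a aM i i'].
- by rewrite mul0r !linear0 mulr0.
- by rewrite mulrDl -scalerAl !linearP Hx Hx' mulrDr scalerAr.
move: y; apply: multiplicative_family_ind => [|c y y' Hy Hy'|m b bM j j'].
- by rewrite mulr0 !linear0 mul0r.
- by rewrite mulrDr -scalerAr !linearP Hy Hy' mulrDl scalerAl.
have aM_bM := multiplicative_familyM (comul_monoid_morphism hA) aM bM.
apply: (family_inv_uniq (antipode_familyl aM_bM) _ (i, j) (i', j')
  (c := fun p q : 'I_n * 'I_m => S (b p.2 q.2) * S (a p.1 q.1))).
exact: kronecker_inv (antipode_familyr aM) (antipode_familyr bM).
Qed.

Lemma antipode1 : S 1 = 1.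
Proof.
have := antipode_familyl
  (multiplicative_family1 _ (comul_monoid_morphism hA)) tt tt.
by rewrite (big_pred1 tt) ?mulr1 //; case.
Qed.

End HopfAlgebraTheory.

Section BialgebraMorphisms.
Variables (k : fieldType) (A B : algType k) (hA : hopf A) (hB : hopf B).
Variable f : {lrmorphism A -> B}.
Hypothesis fD : forall x, comul hB (f x) = tmap f f (comul hA x).
Hypothesis fe : forall x, counit hB (f x) = counit hA x.

Lemma multiplicative_family_morph (I : finType) (a : I -> I -> A) :
  multiplicative_family (comul hA) (counit hA) a ->
  multiplicative_family (comul hB) (counit hB) (fun i j => f (a i j)).
Proof.
by move=> [aD ae]; split=> i j; rewrite ?fD ?aD ?tmap_sum ?fe.
Qed.

(** On a multiplicative family [a], the left side is a left inverse of [f a] and the right side is a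
    right inverse. *)
Lemma bialgebra_morph_antipode x : antipode hB (f x) = f (antipode hA x).
Proof.
move: x; apply: (multiplicative_family_ind (hA := hA))
  => [|c x y Hx Hy|n a aM i j].
- by rewrite !linear0.
- by rewrite !linearP Hx Hy.
apply: (family_inv_uniq
  (antipode_familyl (multiplicative_family_morph aM)) _ i j
  (c := fun i j => f (antipode hA (a i j)))).
move=> {}i {}j; rewrite -(rmorph_nat f) -(antipode_familyr aM) rmorph_sum.
by apply: eq_bigr => l _; rewrite rmorphM.
Qed.

End BialgebraMorphisms.

(** * The inverse antipode *)

Section InverseAntipode.
Variables (k : fieldType) (A : algType k) (hA : bijhopf A).
Local Notation S := (antipode hA).
Local Notation S' := (antipode_inv hA).

Lemma antipode_inv_linear : linear S'.
Proof.
move=> c x y; apply: (can_inj (antipodeK hA)).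
by rewrite linearP /= !antipode_invK.
Qed.

Lemma antipode_invM x y : S' (x * y) = S' y * S' x.
Proof.
apply: (can_inj (antipodeK hA)).
by rewrite antipode_invK antipodeM !antipode_invK.
Qed.

Lemma antipode_inv1 : S' 1 = 1.
Proof.
by apply: (can_inj (antipodeK hA)); rewrite antipode_invK antipode1.
Qed.

(** Applying [S'] to the relation for [S a] reverses the factors. As a result [S'(a)^T] inverts
    [a^T], not [a]; this accounts for the transposes in the third and fourth relations of [HF F]. *)
Lemma antipode_inv_familyl (I : finType) (a : I -> I -> A) :
  multiplicative_family (comul hA) (counit hA) a ->
  forall i j, \sum_l S' (a l j) * a i l = (i == j)%:R.
Proof.
move=> aM i j; have := congr1 S' (antipode_familyl aM i j).
rewrite (lin_sum antipode_inv_linear).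
have -> : S' (i == j)%:R = (i == j)%:R.
  by case: (i == j); rewrite ?antipode_inv1 ?(lin0 antipode_inv_linear).
by move=> <-; apply: eq_bigr => l _; rewrite antipode_invM antipodeK.
Qed.
Lemma antipode_inv_familyr (I : finType) (a : I -> I -> A) :
  multiplicative_family (comul hA) (counit hA) a ->
  forall i j, \sum_l a l j * S' (a i l) = (i == j)%:R.
Proof.
move=> aM i j; have := congr1 S' (antipode_familyr aM i j).
rewrite (lin_sum antipode_inv_linear).
have -> : S' (i == j)%:R = (i == j)%:R.
  by case: (i == j);
    rewrite ?antipode_inv1 ?(lin0 antipode_inv_linear).
by move=> <-; apply: eq_bigr => l _; rewrite antipode_invM antipodeK.
Qed.

End InverseAntipode.

Section Generators.
Variables (k : fieldType) (A : algType k) (hA : hopf A).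

Lemma multiplicative_family_seq (s : seq A) :
  exists n (a : 'I_n -> 'I_n -> A), [/\ (0 < n)%N,
    multiplicative_family (comul hA) (counit hA) a &
    {in s, forall x, exists c : 'I_n -> 'I_n -> k,
                       x = \sum_i \sum_j c i j *: a i j}].
Proof.
suff [I [i0 [a [aM as_]]]] : exists (I : finType) (_ : I) (a : I -> I -> A),
    multiplicative_family (comul hA) (counit hA) a /\ {in s, forall x,
      exists c : I -> I -> k, x = \sum_i \sum_j c i j *: a i j}.
  exists #|I|, (fun i j => a (enum_val i) (enum_val j)); split.
  - by apply/card_gt0P; exists i0.
  - by apply: multiplicative_family_reindex aM; exact: enum_val_bij.
  - move=> x /as_[c ->]; exists (fun i j => c (enum_val i) (enum_val j)).
    rewrite (reindex _ (onW_bij _ (@enum_val_bij I))); apply: eq_bigr => i _.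
    by rewrite (reindex _ (onW_bij _ (@enum_val_bij I))).
elim: s => [|x s [I [i0 [a [aM as_]]]]].
  (* Starting from the trivial one-by-one family keeps the index type nonempty, even for an empty
     list. *)
  exists unit, tt, (fun _ _ => 1); split=> //.
  exact/multiplicative_family1/comul_monoid_morphism.
have [n [b [c [bM xE]]]] := multiplicative_family_span hA x.
exists ('I_n + I)%type, (inr i0), (fun p q => match p, q with
  | inl i, inl j => b i j | inr i, inr j => a i j | _, _ => 0 end).
split; [by apply: multiplicative_familyD; rewrite ?raddf0 | move=> y].
rewrite inE => /orP[/eqP-> | /as_[d ->]].
  exists (fun p q => match p, q with inl i, inl j => c i j | _, _ => 0 end).
  rewrite big_sumType /= [X in _ + X]big1 ?addr0 => [|i _]; last first.
    by rewrite big1 // => -[] j _; rewrite scale0r.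
  rewrite xE; apply: eq_bigr => i _; rewrite big_sumType /=.
  by rewrite [X in _ + X]big1 ?addr0 // => j _; rewrite scale0r.
exists (fun p q => match p, q with inr i, inr j => d i j | _, _ => 0 end).
rewrite big_sumType /= [X in X + _]big1 ?add0r => [|i _]; last first.
  by rewrite big1 // => -[] j _; rewrite scale0r.
apply: eq_bigr => i _; rewrite big_sumType /=.
by rewrite [X in X + _]big1 ?add0r // => j _; rewrite scale0r.
Qed.

End Generators.

(** * Hopf algebras presented by multiplicative families *)

Definition generated_by (k : fieldType) (A : algType k) (J : Type)
    (u v : J -> J -> A) : Prop :=
  forall P : A -> Prop,
    P 1 -> (forall c x y, P x -> P y -> P (c *: x + y)) ->
    (forall x y, P x -> P y -> P (x * y)) ->
    (forall i j, P (u i j)) -> (forall i j, P (v i j)) -> forall x, P x.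

(** What [antipode_familyl] and [antipode_familyr] give in a Hopf algebra, here as a condition on a
    candidate antipode. *)
Definition antipodal_family (R : pzRingType) (S : R -> R) (I : finType)
    (a : I -> I -> R) : Prop :=
  (forall i j, \sum_l S (a i l) * a l j = (i == j)%:R) /\
  (forall i j, \sum_l a i l * S (a l j) = (i == j)%:R).

Section HopfOfGenerators.
Variables (k : fieldType) (A : algType k).
Variables (Δ : {linear A -> (A ⊗ A)%type}) (ε : {lrmorphism A -> k^o}).
Variable S : {linear A -> A}.
Hypothesis ΔM : monoid_morphism Δ.
Hypothesis SM : forall x y, S (x * y) = S y * S x.
Hypothesis S1 : S 1 = 1.
Variables (J : finType) (u v : J -> J -> A).
Hypothesis uv_gen : generated_by u v.
Hypothesis uM : multiplicative_family Δ ε u.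
Hypothesis vM : multiplicative_family Δ ε v.
Hypothesis uS : antipodal_family S u.
Hypothesis vS : antipodal_family S v.

Definition multiplicative_entry (x : A) : Prop :=
  exists (I : finType) (a : I -> I -> A) i j,
    [/\ multiplicative_family Δ ε a, antipodal_family S a & x = a i j].

Lemma multiplicative_entryM x y :
  multiplicative_entry x -> multiplicative_entry y ->
  multiplicative_entry (x * y).
Proof.
move=> [I [a [i [j [aM aS ->]]]]] [I' [b [i' [j' [bM bS ->]]]]].
exists (I * I')%type, (fun p q => a p.1 q.1 * b p.2 q.2), (i, i'), (j, j').
split=> //; first exact: multiplicative_familyM.
split=> [] [i1 i2] [j1 j2].
  under eq_bigr => l _ do rewrite SM.
  (* For the left inverse the factors appear in the order [b], [a], so the Kronecker product is
     taken over swapped index pairs and the two sums are exchanged afterwards. *)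
  have := kronecker_inv bS.1 aS.1 (i2, i1) (j2, j1).
  rewrite !xpair_eqE andbC => <- /=.
  rewrite -(pair_bigA _ (fun l m => S (b i2 m) * S (a i1 l) * (a l j1 * b m j2))).
  by rewrite exchange_big pair_bigA.
under eq_bigr => l _ do rewrite SM.
exact: kronecker_inv aS.2 bS.2 (i1, i2) (j1, j2).
Qed.

(** Turns generation as an algebra into spanning as a vector space: the entries contain 1 and the
    generators, and are closed under products. Each Hopf axiom other than multiplicativity is linear
    in [x] and is a direct computation on such an entry. *)
Lemma multiplicative_entry_span x : x \in lspan multiplicative_entry.
Proof.
move: x; apply: uv_gen.
- apply: lspan_gen; exists unit, (fun _ _ => 1), tt, tt; split=> //.
    exact: multiplicative_family1.
  by split=> [[] []|[] []]; rewrite (big_pred1 tt) ?S1 ?mulr1 //; case.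
- by move=> c x y Px Py; rewrite rpredD ?rpredZ.
- move=> x y Px Py; move: x Px.
  apply: (lspan_ind (Q := fun x => x * y \in _)) => [|x Px|c x x' Px Px'].
  + by rewrite mul0r rpred0.
  + move: y Py; apply: (lspan_ind (Q := fun y => x * y \in _))
      => [|y Py|c y y' Py Py'].
    * by rewrite mulr0 rpred0.
    * exact/lspan_gen/multiplicative_entryM.
    * by rewrite mulrDr -scalerAr rpredD ?rpredZ.
  + by rewrite mulrDl -scalerAl rpredD ?rpredZ.
- by move=> i j; apply: lspan_gen; exists J, u, i, j.
- by move=> i j; apply: lspan_gen; exists J, v, i, j.
Qed.

Lemma multiplicative_entry_ext (W : lmodType k) (f g : A -> W) :
  linear f -> linear g ->
  (forall (I : finType) (a : I -> I -> A), multiplicative_family Δ ε a ->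
     antipodal_family S a -> forall i j, f (a i j) = g (a i j)) ->
  f =1 g.
Proof.
move=> fL gL fg x; move: x (multiplicative_entry_span x).
apply: (lspan_ind (Q := fun x => f x = g x)).
- by rewrite (lin0 fL) (lin0 gL).
- by move=> _ [I [a [i [j [aM aS ->]]]]]; exact: fg.
- by move=> c x y fx fy; rewrite fL gL fx fy.
Qed.

Fact hopf_of_generators_comulA x :
  tassoc (tmap Δ idfun (Δ x)) = tmap idfun Δ (Δ x).
Proof.
move: x; apply: multiplicative_entry_ext => [||I a [aD _] _ i j].
- apply: lin_comp; first exact: tassoc_linear.
  by apply: lin_comp; [exact: tmap_linear | exact: linearP].
- by apply: lin_comp; [exact: tmap_linear | exact: linearP].
rewrite aD !tmap_sum (lin_sum (@tassoc_linear _ _ _ _)) /=.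
under eq_bigr => l _ do rewrite aD tpure_suml (lin_sum (@tassoc_linear _ _ _ _)).
rewrite exchange_big /=; apply: eq_bigr => l _.
rewrite aD tpure_sumr; apply: eq_bigr => m _.
exact: tassocE.
Qed.

Fact hopf_of_generators_counitl x :
  tlift (fun a b => ε a *: b) (Δ x) = x.
Proof.
move: x; apply: (multiplicative_entry_ext (f := fun x => contractl ε (Δ x)))
  => [||I a [aD ae] _ i j] //.
- by apply: lin_comp; [exact: contractl_linear | exact: linearP].
rewrite aD contractl_sum.
under eq_bigr => l _ do rewrite /= ae.
exact: sum_deltaZ.
Qed.

Fact hopf_of_generators_counitr x :
  tlift (fun a b => ε b *: a) (Δ x) = x.
Proof.
move: x; apply: (multiplicative_entry_ext (f := fun x => contractr ε (Δ x)))
  => [||I a [aD ae] _ i j] //.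
- by apply: lin_comp; [exact: contractr_linear | exact: linearP].
rewrite aD contractr_sum.
under eq_bigr => l _ do rewrite /= ae eq_sym.
exact: sum_deltaZ.
Qed.

Let idL : linear (fun x : A => x). Proof. by []. Qed.

Let unit_counit_linear : linear (fun x => (ε x)%:A : A).
Proof. by move=> c x y; rewrite linearP scalerDl scalerA. Qed.

Fact hopf_of_generators_antipodel x :
  tlift (fun a b => S a * b) (Δ x) = (ε x)%:A.
Proof.
have B := mul_linear_bilin (linearP S) idL.
move: x; apply: multiplicative_entry_ext => // [|I a [aD ae] [aS _] i j].
  by apply: lin_comp; [exact: tlift_linear | exact: linearP].
by rewrite aD (tlift_sum _ _ B) aS ae scaler_nat.
Qed.

Fact hopf_of_generators_antipoder x :
  tlift (fun a b => a * S b) (Δ x) = (ε x)%:A.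
Proof.
have B := mul_linear_bilin idL (linearP S).
move: x; apply: multiplicative_entry_ext => // [|I a [aD ae] [_ aS] i j].
  by apply: lin_comp; [exact: tlift_linear | exact: linearP].
by rewrite aD (tlift_sum _ _ B) aS ae scaler_nat.
Qed.

Definition hopf_of_generators : hopf A :=
  Hopf ΔM hopf_of_generators_comulA hopf_of_generators_counitl
    hopf_of_generators_counitr hopf_of_generators_antipodel
    hopf_of_generators_antipoder.

End HopfOfGenerators.

(** * Convolution and sovereign characters *)

Section Convolution.
Variables (k : fieldType) (A B : algType k) (hA : hopf A) (f g : A -> B).
Hypotheses (fL : linear f) (gL : linear g).

Lemma convolution_linear : linear (convolution hA f g).
Proof.
apply: lin_comp; last exact: linearP.
exact/tlift_linear/mul_linear_bilin.
Qed.

Lemma convolution_family (I : finType) (a : I -> I -> A) i j :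
  multiplicative_family (comul hA) (counit hA) a ->
  convolution hA f g (a i j) = \sum_l f (a i l) * g (a l j).
Proof.
move=> [aD _]; rewrite /convolution aD tlift_sum //.
exact: mul_linear_bilin.
Qed.

Lemma convolution1 : convolution hA f g 1 = f 1 * g 1.
Proof.
rewrite /convolution (comul_monoid_morphism hA).1.
exact/tliftE/mul_linear_bilin.
Qed.

(** The hypothesis is the property on pure tensors. It covers two characters with values in the
    commutative [k], and also an anti-multiplicative map convolved with a character, whose values
    are central. *)
Lemma convolution_antimul :
  (forall a b a' b', f (a * a') * g (b * b') = (f a' * g b') * (f a * g b)) ->
  forall x y,
    convolution hA f g (x * y) = convolution hA f g y * convolution hA f g x.
Proof.
move=> fg x y; rewrite /convolution (comul_monoid_morphism hA).2.
have fgB := mul_linear_bilin fL gL; set L := tlift _.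
have LL : linear L by exact: tlift_linear.
have mulrL (R : algType k) (z : R) : linear (fun x => z * x).
  by move=> c s t; rewrite mulrDr scalerAr.
have mullL (R : algType k) (z : R) : linear (fun x => x * z).
  by move=> c s t; rewrite mulrDl scalerAl.
move: (comul hA x) (comul hA y) => s t; move: s.
apply: tensor_ext => [||a b].
- by apply: lin_comp => // c s s'; rewrite [LHS]tmul_linearl.
- exact: (lin_comp (mulrL _ _)).
move: t; apply: tensor_ext => [||a' b'].
- by apply: lin_comp => // c s s'; rewrite [LHS]tmul_linearr.
- exact: (lin_comp (mullL _ _)).
by rewrite tpureM /L !(tliftE fgB) fg.
Qed.

End Convolution.

Section SovereignOfGenerators.
Variables (k : fieldType) (A : algType k) (hA : bijhopf A).
Local Notation S := (antipode hA).
Local Notation S' := (antipode_inv hA).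
Variables (J : finType) (u v : J -> J -> A) (Phi Psi : {lrmorphism A -> k^o}).
Hypothesis uv_gen : generated_by u v.
Hypothesis uM : multiplicative_family (comul hA) (counit hA) u.
Hypothesis vM : multiplicative_family (comul hA) (counit hA) v.

(** Since [k] is commutative, the convolution of two characters is multiplicative, so it is
    determined by the generators. *)
Lemma convolution_characters_counit (f g : {lrmorphism A -> k^o}) :
  (forall i j, \sum_l f (u i l) * g (u l j) = (i == j)%:R) ->
  (forall i j, \sum_l f (v i l) * g (v l j) = (i == j)%:R) ->
  convolution hA f g =1 counit hA.
Proof.
have fL : linear f := linearP f.
have gL : linear g := linearP g.
move=> fgu fgv; apply: uv_gen => [|c x y Hx Hy|x y Hx Hy|i j|i j].
- by rewrite convolution1 ?rmorph1 ?mulr1.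
- by rewrite convolution_linear // Hx Hy linearP.
- rewrite convolution_antimul //; last first.
    by move=> a b a' b'; rewrite !rmorphM /= mulrACA mulrC.
  by rewrite Hx Hy rmorphM mulrC.
- by rewrite (convolution_family _ _ _ _ uM) // fgu uM.2.
- by rewrite (convolution_family _ _ _ _ vM) // fgv vM.2.
Qed.

Hypothesis PhiPsi_u : forall i j, \sum_l Phi (u i l) * Psi (u l j) = (i == j)%:R.
Hypothesis PsiPhi_u : forall i j, \sum_l Psi (u i l) * Phi (u l j) = (i == j)%:R.
Hypothesis PhiPsi_v : forall i j, \sum_l Phi (v i l) * Psi (v l j) = (i == j)%:R.
Hypothesis PsiPhi_v : forall i j, \sum_l Psi (v i l) * Phi (v l j) = (i == j)%:R.
Hypothesis Su : forall i j, S' (u i j) =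
  \sum_m (\sum_l (Phi (u i l))%:A * S (u l m)) * (Psi (u m j))%:A.
Hypothesis Sv : forall i j, S' (v i j) =
  \sum_m (\sum_l (Phi (v i l))%:A * S (v l m)) * (Psi (v m j))%:A.

(** Both [S'] and [Phi * S * Psi] are linear, unital and anti-multiplicative, so agreement on the
    generators suffices. *)
Lemma sovereign_of_generators : sovereign hA Phi.
Proof.
exists Psi; first by split; exact: convolution_characters_counit.
have charL (f : {lrmorphism A -> k^o}) : linear (fun x => (f x)%:A : A).
  by move=> c x y; rewrite linearP scalerDl scalerA.
have SL : linear S := linearP S.
have PSL := convolution_linear hA (charL Phi) SL.
apply: uv_gen => [|c x y Hx Hy|x y Hx Hy|i j|i j].
- rewrite !convolution1 ?rmorph1 //= antipode1 antipode_inv1.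
  by rewrite !scale1r !mulr1.
- by rewrite antipode_inv_linear Hx Hy (convolution_linear hA PSL (charL Psi)).
- rewrite antipode_invM Hx Hy; apply/esym.
  apply: (convolution_antimul hA PSL (charL Psi)) => a b a' b'.
  rewrite (convolution_antimul hA (charL Phi) SL).
    by rewrite rmorphM /= !mulr_algr -!scalerAl -!scalerAr !scalerA mulrC.
  move=> {}a {}b {}a' {}b'.
  rewrite rmorphM antipodeM /= !mulr_algl -!scalerAl -!scalerAr !scalerA.
  by rewrite mulrC.
- rewrite (convolution_family PSL (charL Psi) _ _ uM) Su.
  by apply: eq_bigr => l _; rewrite (convolution_family (charL Phi) SL _ _ uM).
- rewrite (convolution_family PSL (charL Psi) _ _ vM) Sv.
  by apply: eq_bigr => l _; rewrite (convolution_family (charL Phi) SL _ _ vM).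
Qed.

End SovereignOfGenerators.

(** * Morphisms and coactions defined by multiplicative families *)

Section AntipodeFamily.
Variables (k : fieldType) (A : algType k) (hA : hopf A).
Local Notation Δ := (comul hA).
Local Notation ε := (counit hA).
Local Notation S := (antipode hA).

(* In the ring [A ⊗ A], both sides of [Δ (S a_ij) = Σ_l S a_lj ⊗ S a_il] are the
   entries of the inverse of [Δ a]. *)
Lemma antipode_multiplicative_family (I : finType) (a : I -> I -> A) :
  multiplicative_family Δ ε a ->
  multiplicative_family Δ ε (fun i j => S (a j i)).
Proof.
move=> aM; have [aD ae] := aM; have [Δ1 ΔM] := comul_monoid_morphism hA.
have Δnat (b : bool) : Δ b%:R = b%:R by case: b; rewrite ?Δ1 ?linear0.
split=> i j; last first.
  have := congr1 ε (antipode_familyl aM j i); rewrite rmorph_sum rmorph_nat /=.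
  under eq_bigr => l _ do rewrite rmorphM /= ae.
  by rewrite eq_sym => <-; rewrite (sum_deltar (R := k)).
apply: (family_inv_uniq (a := fun i j => Δ (a i j))
  (b := fun i j => Δ (S (a i j)))
  (c := fun i j => \sum_l S (a l j) ⊗ S (a i l))) => {}i {}j.
  rewrite -Δnat -(antipode_familyl aM) linear_sum.
  by apply: eq_bigr => l _; rewrite ΔM.
(* Summing over [l] in the second tensor factor first gives [Σ_l a_pl S(a_lq) = δ_pq], which leaves
   only the terms with [q = p]. *)
transitivity (\sum_p (a i p * S (a p j)) ⊗ (1 : A)).
  under eq_bigr => l _ do rewrite aD mulr_suml.
  rewrite exchange_big /=; apply: eq_bigr => p _.
  under eq_bigr => l _ do rewrite mulr_sumr.
  rewrite exchange_big /= -[RHS]addr0 (bigD1 p) //=; congr (_ + _).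
    under eq_bigr => l _ do rewrite tpureM.
    by rewrite -tpure_sumr (antipode_familyr aM) eqxx.
  rewrite big1 // => q qp.
  under eq_bigr => l _ do rewrite tpureM.
  by rewrite -tpure_sumr (antipode_familyr aM) eq_sym (negPf qp) tpure0r.
rewrite -tpure_suml (antipode_familyr aM) -Δnat.
by case: (i == j); rewrite ?Δ1 ?linear0 ?tpure0l.
Qed.

End AntipodeFamily.

Section MorphismOfGenerators.
Variables (k : fieldType) (A B : algType k) (hA : hopf A) (hB : hopf B).
Variables (J : finType) (u v : J -> J -> A) (f : {lrmorphism A -> B}).
Local Notation multA := (multiplicative_family (comul hA) (counit hA)).
Local Notation multB := (multiplicative_family (comul hB) (counit hB)).

Lemma tmapM (s t : (A ⊗ A)%type) : tmap f f (s * t) = tmap f f s * tmap f f t.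
Proof.
have tL := tmap_linear f f.
have mAl t' : linear (fun s : (A ⊗ A)%type => s * t') := @tmul_linearl k A A t'.
have mAr s' : linear (fun t : (A ⊗ A)%type => s' * t) := @tmul_linearr k A A s'.
have mBl t' : linear (fun s : (B ⊗ B)%type => s * t') := @tmul_linearl k B B t'.
have mBr s' : linear (fun t : (B ⊗ B)%type => s' * t) := @tmul_linearr k B B s'.
move: s; apply: tensor_ext => [||a b].
- exact: (lin_comp tL (mAl t)).
- exact: (lin_comp (mBl _) tL).
move: t; apply: tensor_ext => [||a' b'].
- exact: (lin_comp tL (mAr _)).
- exact: (lin_comp (mBr _) tL).
by rewrite tpureM !tmapE tpureM /= !rmorphM.
Qed.

(** Compatibility with the comultiplication and with the counit passes from generators to products;
    the antipode then follows for any bialgebra morphism. *)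
Lemma hopf_morphism_of_generators :
  generated_by u v -> multA u -> multA v ->
  multB (fun i j => f (u i j)) -> multB (fun i j => f (v i j)) ->
  hopf_morphism hA hB f.
Proof.
move=> uv_gen uM vM fuM fvM.
have fD : forall x, comul hB (f x) = tmap f f (comul hA x).
  apply: uv_gen => [|c x y Hx Hy|x y Hx Hy|i j|i j].
  - rewrite rmorph1 (comul_monoid_morphism hA).1 (comul_monoid_morphism hB).1.
    by rewrite tmapE /= rmorph1.
  - by rewrite !linearP Hx Hy tmap_linear.
  - rewrite rmorphM (comul_monoid_morphism hA).2 (comul_monoid_morphism hB).2.
    by rewrite Hx Hy tmapM.
  - by rewrite fuM.1 uM.1 tmap_sum.
  - by rewrite fvM.1 vM.1 tmap_sum.
have fe : forall x, counit hB (f x) = counit hA x.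
  apply: uv_gen => [|c x y Hx Hy|x y Hx Hy|i j|i j].
  - by rewrite !rmorph1.
  - by rewrite !linearP /= Hx Hy.
  - by rewrite !rmorphM /= Hx Hy.
  - by rewrite fuM.2 uM.2.
  - by rewrite fvM.2 vM.2.
by split=> // x; exact: bialgebra_morph_antipode.
Qed.

End MorphismOfGenerators.

Section CoactionFamily.
Variables (k : fieldType) (A : algType k) (hA : hopf A).
Variables (V : vectType k) (n : nat) (e : n.-tuple V).
Hypothesis eB : basis_of fullv e.

Lemma basis_sum_coord x : x = \sum_(i < n) coord e i x *: e`_i.
Proof. exact: coord_basis eB (memvf x). Qed.

Lemma basis_linear_ext (W : lmodType k) (f g : V -> W) :
  linear f -> linear g -> (forall i : 'I_n, f e`_i = g e`_i) -> f =1 g.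
Proof.
move=> fL gL fg x; rewrite [x]basis_sum_coord (lin_sum fL) (lin_sum gL).
by apply: eq_bigr => i _; rewrite (linZ fL) (linZ gL) fg.
Qed.

Lemma coord_basisE (i j : 'I_n) : coord e j e`_i = (i == j)%:R.
Proof. exact/coord_free/basis_free/eB. Qed.

Definition family_coaction (a : 'M[A]_n) (x : V) : (V ⊗ A)%type :=
  \sum_(i < n) coord e i x *: \sum_(j < n) e`_j ⊗ a j i.

Fact family_coaction_linear a : linear (family_coaction a).
Proof.
move=> c x y; rewrite /family_coaction scaler_sumr -big_split.
by apply: eq_bigr => i _; rewrite linearP scalerDl scalerA.
Qed.

HB.instance Definition _ a :=
  GRing.isLinear.Build k V (V ⊗ A)%type _ (family_coaction a)
    (family_coaction_linear a).

Lemma family_coactionE a (i : 'I_n) :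
  family_coaction a e`_i = \sum_(j < n) e`_j ⊗ a j i.
Proof.
rewrite /family_coaction.
under eq_bigr => l _ do rewrite coord_basisE.
exact: sum_deltaZ.
Qed.

Lemma family_coactionP (a : 'M[A]_n) :
  multiplicative_family (comul hA) (counit hA) a ->
  coaction hA (family_coaction a).
Proof.
move=> [aD ae]; have aL := family_coaction_linear a; split.
  apply: basis_linear_ext => [||i].
  - apply: lin_comp; first exact: tassoc_linear.
    by apply: lin_comp; first exact: tmap_linear.
  - by apply: lin_comp; first exact: tmap_linear.
  rewrite /= family_coactionE !tmap_sum (lin_sum (@tassoc_linear _ _ _ _)) /=.
  under eq_bigr => l _ do
    rewrite family_coactionE tpure_suml (lin_sum (@tassoc_linear _ _ _ _)).
  rewrite exchange_big /=; apply: eq_bigr => l _.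
  rewrite aD tpure_sumr; apply: eq_bigr => m _.
  exact: tassocE.
apply: (basis_linear_ext
  (f := fun v => contractr (counit hA) (family_coaction a v))) => // [|i].
  by apply: lin_comp; first exact: contractr_linear.
rewrite family_coactionE contractr_sum.
under eq_bigr => l _ do rewrite /= ae eq_sym.
exact: sum_deltaZ.
Qed.

Variable alpha : {linear V -> (V ⊗ A)%type}.
Local Notation a := (coaction_mx e alpha).

Lemma coaction_mxE (i : 'I_n) : alpha e`_i = \sum_(j < n) e`_j ⊗ a j i.
Proof.
rewrite /coaction_mx; under eq_bigr => j _ do rewrite mxE.
(* Expansion of a tensor along the basis of its first factor: [t = Σ_j e_j ⊗ (e_j^* ⊗ id) t]. *)
pose h t : (V ⊗ A)%type :=
  \sum_(j < n) e`_j ⊗ contractl (coord e j : {linear V -> k^o}) t.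
suff hE t : t = h t by exact: hE.
move: t; apply: (tensor_ext (f := fun t => t)) => // [c s t|w x].
  rewrite /h scaler_sumr -big_split; apply: eq_bigr => j _.
  by rewrite contractl_linear tpure_linearr.
rewrite [w in LHS]basis_sum_coord tpure_suml; apply: eq_bigr => j _.
by rewrite contractlE tpureZl tpureZr.
Qed.

(** Both identities are the coefficients at [e_i] of the coaction axioms evaluated at [e_j]. *)
Lemma coaction_mx_multiplicative : coaction hA alpha ->
  multiplicative_family (comul hA) (counit hA) a.
Proof.
case=> aA a1; split=> i j.
  have := congr1 (contractl (coord e i : {linear V -> k^o})) (aA e`_j).
  rewrite coaction_mxE !tmap_sum contractl_sum.
  under [RHS]eq_bigr => l _ do rewrite /= coord_basisE eq_sym.
  rewrite sum_deltaZ => <-.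
  rewrite (lin_sum (@tassoc_linear _ _ _ _)) linear_sum.
  apply: eq_bigr => l _; rewrite coaction_mxE tpure_suml.
  rewrite (lin_sum (@tassoc_linear _ _ _ _)) linear_sum /=.
  under eq_bigr => m _ do rewrite tassocE contractlE /= coord_basisE eq_sym.
  by rewrite sum_deltaZ.
have := congr1 (coord e i) (a1 e`_j).
rewrite coaction_mxE -[tlift _ _]/(contractr (counit hA) _) contractr_sum.
rewrite coord_basisE linear_sum eq_sym => <-.
under [RHS]eq_bigr => l _ do rewrite linearZ /= coord_basisE.
by rewrite -[RHS]/(\sum_l counit hA (a l j) * (l == i)%:R) (sum_deltar (R := k)).
Qed.

End CoactionFamily.

Section MatrixEntries.
Variables (n : nat).

(** The relations of [HF F] are matrix equations, while families are handled through sums of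
    entries; this lemma and the next ones translate. *)
Lemma mx_entries_mul (R : pzRingType) (X Y Z : 'M[R]_n) :
  X *m Y = Z -> forall i j, \sum_l X i l * Y l j = Z i j.
Proof. by move=> <- i j; rewrite mxE. Qed.

Lemma antipodal_mx (R : pzRingType) (S : R -> R) (X Y : 'M[R]_n) :
  map_mx S X = Y -> Y *m X = 1%:M -> X *m Y = 1%:M -> antipodal_family S X.
Proof.
move=> <- YX XY; split=> i j.
  have := mx_entries_mul YX i j; rewrite mxE => <-.
  by apply: eq_bigr => l _; rewrite mxE.
have := mx_entries_mul XY i j; rewrite mxE => <-.
by apply: eq_bigr => l _; rewrite mxE.
Qed.

Lemma convolution_mx_entries (T : Type) (R : pzRingType) (f g : T -> R)
    (X : 'M[T]_n) (Y Z : 'M[R]_n) :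
  map_mx f X = Y -> map_mx g X = Z -> Y *m Z = 1%:M ->
  forall i j, \sum_l f (X i l) * g (X l j) = (i == j)%:R.
Proof.
move=> <- <- YZ i j; have := mx_entries_mul YZ i j; rewrite [RHS]mxE => <-.
by apply: eq_bigr => l _; rewrite !mxE.
Qed.

Lemma sovereign_mx_entries (k : fieldType) (A : algType k) (f g : A -> k^o)
    (S S' : A -> A) (X Y : 'M[A]_n) (P Q : 'M[k]_n) :
  map_mx f X = P -> map_mx S X = Y -> map_mx g X = Q ->
  map_mx S' X = amx A P *m Y *m amx A Q ->
  forall i j, S' (X i j) =
    \sum_m (\sum_l (f (X i l))%:A * S (X l m)) * (g (X m j))%:A.
Proof.
move=> <- <- <- E i j; have := congr1 (fun Y : 'M[A]_n => Y i j) E.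
rewrite !mxE => ->; apply: eq_bigr => m _; rewrite !mxE; congr (_ * _).
by apply: eq_bigr => l _; rewrite !mxE.
Qed.

End MatrixEntries.

(** * The Hopf algebra H(F) *)

(* A character of [A] shows that [A ⊗ B] is not the zero ring, as required of an
   algType. *)
Section AugmentedTensor.
Variables (k : fieldType) (A B : algType k) (e : {lrmorphism A -> k^o}).

Definition augmented_tensor of {lrmorphism A -> k^o} : Type := (A ⊗ B)%type.
Local Notation T := (augmented_tensor e).

HB.instance Definition _ := GRing.Lmodule.on T.

Fact augmented_tensor_neq0 : (1 ⊗ 1 : T) != 0.
Proof.
apply/eqP => /(congr1 (contractl e)); rewrite contractlE linear0 rmorph1 scale1r.
by move/eqP; rewrite oner_eq0.
Qed.

HB.instance Definition _ := GRing.Zmodule_isNzRing.Build T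
  (@tmulA k A B) (@tmul1l k A B) (@tmul1r k A B) (@tmulDl k A B) (@tmulDr k A B)
  augmented_tensor_neq0.

Fact augmented_tensor_scalerAl (a : k) (x y : T) : a *: (x * y) = (a *: x) * y.
Proof. exact: esym (linZ (@tmul_linearl k A B y) a x). Qed.

HB.instance Definition _ := GRing.Lmodule_isLalgebra.Build k T
  augmented_tensor_scalerAl.

Fact augmented_tensor_scalerAr (a : k) (x y : T) : a *: (x * y) = x * (a *: y).
Proof. exact: esym (linZ (@tmul_linearr k A B x) a y). Qed.

HB.instance Definition _ := GRing.Lalgebra_isAlgebra.Build k T
  augmented_tensor_scalerAr.

End AugmentedTensor.

(** * The opposite algebra and products with scalar matrices *)

Section OppositeAlgebra.
Variables (k : fieldType) (A : algType k).

(** An anti-multiplicative unital linear map into [A] is an algebra morphism into this copy of [A],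
    so the universal property of [HF F] can produce it. *)
Definition opposite : Type := A.

HB.instance Definition _ := GRing.Lmodule.on opposite.

Definition opposite_mul (x y : opposite) : opposite := (y : A) * (x : A).

Fact opposite_mulA : associative opposite_mul.
Proof. by move=> x y z; rewrite /opposite_mul mulrA. Qed.

Fact opposite_mul1l : left_id (1 : A) opposite_mul.
Proof. by move=> x; rewrite /opposite_mul mulr1. Qed.

Fact opposite_mul1r : right_id (1 : A) opposite_mul.
Proof. by move=> x; rewrite /opposite_mul mul1r. Qed.

Fact opposite_mulDl : left_distributive opposite_mul +%R.
Proof. by move=> x y z; rewrite /opposite_mul -mulrDr. Qed.

Fact opposite_mulDr : right_distributive opposite_mul +%R.
Proof. by move=> x y z; rewrite /opposite_mul -mulrDl. Qed.

Fact opposite_oner_neq0 : (1 : A) != 0 :> opposite.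
Proof. exact: oner_neq0. Qed.

HB.instance Definition _ := GRing.Zmodule_isNzRing.Build opposite
  opposite_mulA opposite_mul1l opposite_mul1r opposite_mulDl opposite_mulDr
  opposite_oner_neq0.

Lemma opposite_mulE (x y : opposite) : x * y = opposite_mul x y.
Proof. by []. Qed.

Fact opposite_scalerAl (a : k) (x y : opposite) :
  a *: (x * y) = (a *: x : opposite) * y.
Proof. rewrite !opposite_mulE; exact: (@scalerAr k A a y x). Qed.

HB.instance Definition _ := GRing.Lmodule_isLalgebra.Build k opposite
  opposite_scalerAl.

Fact opposite_scalerAr (a : k) (x y : opposite) :
  a *: (x * y) = x * (a *: y : opposite).
Proof. rewrite !opposite_mulE; exact: (@scalerAl k A a y x). Qed.

HB.instance Definition _ := GRing.Lalgebra_isAlgebra.Build k opposite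
  opposite_scalerAr.

Lemma mulmx_opposite n (X Y : 'M[A]_n) :
  @mulmx opposite n n n X Y = ((Y^T *m X^T)^T : 'M[A]_n).
Proof.
apply/matrixP=> i j; rewrite !mxE; apply: eq_bigr => l _.
by rewrite opposite_mulE !mxE.
Qed.

End OppositeAlgebra.

Lemma opposite_morphM (k : fieldType) (A B : algType k)
    (f : {lrmorphism B -> opposite A}) x y :
  (f (x * y) : A) = (f y : A) * (f x : A).
Proof. by rewrite rmorphM opposite_mulE. Qed.

Section ScalarMatrices.
Variables (k : fieldType) (n : nat) (A : algType k).
Implicit Types (X Y : 'M[A]_n) (M N : 'M[k]_n).

Lemma amxM M N : amx A (M *m N) = amx A M *m amx A N.
Proof. exact: map_mxM. Qed.

Lemma amx1 : amx A 1%:M = 1%:M :> 'M[A]_n.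
Proof. exact: map_mx1. Qed.

Lemma amx_tr M : amx A M^T = (amx A M)^T.
Proof. by rewrite /amx map_trmx. Qed.

(** Over a noncommutative ring, transposition reverses this product because scalar entries are
    central. *)
Lemma trmx_amx_mull M X : (amx A M *m X)^T = X^T *m amx A M^T.
Proof.
apply/matrixP=> i j; rewrite !mxE; apply: eq_bigr => l _.
by rewrite !mxE mulr_algl mulr_algr.
Qed.

Lemma trmx_amx_mulr M X : (X *m amx A M)^T = amx A M^T *m X^T.
Proof.
apply/matrixP=> i j; rewrite !mxE; apply: eq_bigr => l _.
by rewrite !mxE mulr_algl mulr_algr.
Qed.

Lemma amx_mulV M X : M \in unitmx -> amx A M *m (amx A (invmx M) *m X) = X.
Proof. by move=> Mu; rewrite mulmxA -amxM mulmxV // amx1 mul1mx. Qed.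

Lemma amx_mulVK M X : M \in unitmx -> amx A (invmx M) *m (amx A M *m X) = X.
Proof. by move=> Mu; rewrite mulmxA -amxM mulVmx // amx1 mul1mx. Qed.

Lemma amx_mulrV M X : M \in unitmx -> X *m amx A M *m amx A (invmx M) = X.
Proof. by move=> Mu; rewrite -mulmxA -amxM mulmxV // amx1 mulmx1. Qed.

Lemma amx_mulrVK M X : M \in unitmx -> X *m amx A (invmx M) *m amx A M = X.
Proof. by move=> Mu; rewrite -mulmxA -amxM mulVmx // amx1 mulmx1. Qed.

End ScalarMatrices.

Section MapScalarMatrices.
Variables (k : fieldType) (n : nat) (A B : algType k) (h : A -> B).
Hypothesis hL : linear h.
Implicit Types (M : 'M[k]_n) (X : 'M[A]_n).

Lemma map_amx_mull M X : map_mx h (amx A M *m X) = amx B M *m map_mx h X.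
Proof.
apply/matrixP=> i j; rewrite !mxE (lin_sum hL); apply: eq_bigr => l _.
by rewrite !mxE !mulr_algl (linZ hL).
Qed.

Lemma map_amx_mulr M X : map_mx h (X *m amx A M) = map_mx h X *m amx B M.
Proof.
apply/matrixP=> i j; rewrite !mxE (lin_sum hL); apply: eq_bigr => l _.
by rewrite !mxE !mulr_algr (linZ hL).
Qed.

End MapScalarMatrices.

Lemma amx_conj_trK (k : fieldType) (n : nat) (A : algType k) (M : 'M[k]_n)
    (X : 'M[A]_n) : M \in unitmx ->
  amx A M *m (amx A M^T *m X^T *m amx A (invmx M^T))^T *m amx A (invmx M) = X.
Proof.
move=> Mu; rewrite trmx_amx_mulr trmx_amx_mull !trmxK trmx_inv trmxK.
by rewrite amx_mulV // amx_mulrV.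
Qed.

Lemma amx_conjK (k : fieldType) (n : nat) (A : algType k) (M : 'M[k]_n)
    (X : 'M[A]_n) : M \in unitmx ->
  amx A (invmx M) *m (amx A M *m X *m amx A (invmx M)) *m amx A M = X.
Proof.
by move=> Mu; rewrite -!mulmxA amx_mulVK // -amxM mulVmx // amx1 mulmx1.
Qed.

Lemma map_mx_tr_eq (A B : Type) (n : nat) (h : A -> B) (X : 'M[A]_n)
    (Y : 'M[B]_n) : map_mx h X = Y^T -> map_mx h X^T = Y.
Proof. by rewrite -map_trmx => ->; rewrite trmxK. Qed.

(** The cancellation that makes the two antipode formulas inverse to each other: [h = S^-1],
    [M = F], [X = u] gives [S^-1 (S v) = v], and [h = S], [M = F^T], [X = v] gives
    [S (S^-1 u) = u]. *)
Lemma map_mx_conj_eq (k : fieldType) (n : nat) (A B : algType k) (h : A -> B)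
    (M : 'M[k]_n) (X : 'M[A]_n) (Y : 'M[B]_n) : linear h -> M \in unitmx ->
  map_mx h X = amx B M^T *m Y^T *m amx B (invmx M^T) ->
  map_mx h (amx A M *m X^T *m amx A (invmx M)) = Y.
Proof.
move=> hL Mu hX; rewrite (map_amx_mulr hL) (map_amx_mull hL) -map_trmx hX.
exact: amx_conj_trK.
Qed.

Section HFRelations.
Variables (k : fieldType) (n : nat) (F : glmx k n) (A : algType k).
Implicit Types (U V : 'M[A]_n).

Lemma glmx_unit : (F : 'M[k]_n) \in unitmx.
Proof. exact: valP F. Qed.

(** In this form the last two relations say that [V _ U^T] fixes [F] and [U^T _ V] fixes [F^-1], a
    shape that composes under matrix products. *)
Lemma HF_relationsP U V :
  HF_relations F U V <->
  [/\ U *m V^T = 1%:M, V^T *m U = 1%:M,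
      V *m amx A F *m U^T = amx A F &
      U^T *m amx A (invmx F) *m V = amx A (invmx F)].
Proof.
have Fu := glmx_unit.
split=> [] [UV VU E1 E2]; split=> //.
- by rewrite -[LHS](amx_mulrVK _ Fu) E1 mul1mx.
- rewrite -[LHS](amx_mulVK _ Fu).
  by rewrite (_ : amx A F *m _ = 1%:M) ?mulmx1 // !mulmxA.
- by rewrite E1 -amxM mulmxV // amx1.
- by rewrite -!mulmxA [U^T *m _]mulmxA E2 -amxM mulmxV // amx1.
Qed.

Lemma HF_relations_opposite U V :
  V *m U^T = 1%:M -> U^T *m V = 1%:M ->
  amx A (invmx F)^T *m U *m amx A F^T *m V^T = 1%:M ->
  V^T *m amx A (invmx F)^T *m U *m amx A F^T = 1%:M ->
  @HF_relations k n F (opposite A) U V.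
Proof.
have op1 : (1%:M : 'M[A]_n) = (1%:M : 'M[opposite A]_n) by [].
have amxE M : amx (opposite A) M = amx A M :> 'M[A]_n by [].
move=> VU UV E1 E2; split; rewrite !mulmx_opposite !(trmxK, amxE).
- by rewrite VU trmx1.
- by rewrite UV trmx1.
- by rewrite -!amx_tr !mulmxA E1 trmx1.
- by rewrite -!amx_tr !mulmxA E2 trmx1.
Qed.

Let FTu : (F : 'M[k]_n)^T \in unitmx.
Proof. by rewrite unitmx_tr glmx_unit. Qed.

Lemma HF_relations_antipode U V : HF_relations F U V ->
  @HF_relations k n F (opposite A) V^T (amx A F *m U^T *m amx A (invmx F)).
Proof.
move=> [E1 E2 E3 E4].
have V' : (amx A F *m U^T *m amx A (invmx F))^T =
    amx A (invmx F^T) *m U *m amx A F^T.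
  by rewrite trmx_amx_mulr trmx_amx_mull trmxK trmx_inv mulmxA.
apply: HF_relations_opposite; rewrite ?trmxK ?V' ?trmx_inv.
- by rewrite E4.
- by rewrite !mulmxA E3.
- rewrite !mulmxA amx_mulrV // -[_ *m V^T *m U]mulmxA E2 mulmx1.
  by rewrite -amxM mulVmx // amx1.
- by rewrite amx_mulrV // -[_ *m U *m V^T]mulmxA E1 mulmx1 -amxM mulVmx // amx1.
Qed.

Lemma HF_relations_antipode_inv U V : HF_relations F U V ->
  @HF_relations k n F (opposite A)
    (amx A F^T *m V^T *m amx A (invmx F^T)) U^T.
Proof.
move=> UV; have [E1 E2 E3 E4] := UV.
have [_ _ E3' E4'] := (HF_relationsP U V).1 UV.
have Fu := glmx_unit.
have U' : (amx A F^T *m V^T *m amx A (invmx F^T))^T =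
    amx A (invmx F) *m V *m amx A F.
  by rewrite trmx_amx_mulr trmx_amx_mull !trmxK trmx_inv trmxK mulmxA.
apply: HF_relations_opposite; rewrite ?trmxK ?U' ?trmx_inv.
- by rewrite !mulmxA E4' -amxM mulVmx // amx1.
- by rewrite -mulmxA -mulmxA [V *m _]mulmxA E3' -amxM mulVmx // amx1.
- by rewrite !mulmxA -amxM mulVmx // amx1 mul1mx amx_mulrVK.
- by rewrite !mulmxA !amx_mulrVK.
Qed.

End HFRelations.

Section HFRelationsMorphism.
Variables (k : fieldType) (n : nat) (F : glmx k n).

Lemma HF_relations_map (A B : algType k) (f : {lrmorphism A -> B})
    (U V : 'M[A]_n) :
  HF_relations F U V -> HF_relations F (map_mx f U) (map_mx f V).
Proof.
move=> [E1 E2 E3 E4]; split.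
- by rewrite -map_uvT E1 map_mx1.
- by rewrite -map_vTu E2 map_mx1.
- by rewrite -map_vMuTN E3 map_mx1.
- by rewrite -map_MuTNv E4 map_mx1.
Qed.

Lemma trmx_mul_comm (A : algType k) (X Y : 'M[A]_n) :
  (forall i j l m, X i j * Y l m = Y l m * X i j) -> (X *m Y)^T = Y^T *m X^T.
Proof.
move=> XY; apply/matrixP=> i j; rewrite !mxE; apply: eq_bigr => l _.
by rewrite !mxE XY.
Qed.

(** The commutation makes transposition reverse the products, and then
    [V (V' F U'^T) U^T = V F U^T = F]. It is meant for entries in the two factors of a tensor
    product. *)
Lemma HF_relations_mul (A : algType k) (U V U' V' : 'M[A]_n) :
  (forall i j l m, U i j * U' l m = U' l m * U i j) ->
  (forall i j l m, V i j * V' l m = V' l m * V i j) ->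
  HF_relations F U V -> HF_relations F U' V' ->
  HF_relations F (U *m U') (V *m V').
Proof.
move=> UU' VV' /HF_relationsP[E1 E2 E3 E4] /HF_relationsP[E1' E2' E3' E4'].
apply/HF_relationsP; rewrite !trmx_mul_comm //; split.
- by rewrite -mulmxA [U' *m _]mulmxA E1' mul1mx.
- by rewrite -mulmxA [V^T *m _]mulmxA E2 mul1mx.
- by rewrite mulmxA -[V *m V' *m _]mulmxA -[V *m _ *m U'^T]mulmxA E3'.
- by rewrite mulmxA -[U'^T *m U^T *m _]mulmxA -[U'^T *m _ *m V]mulmxA E4.
Qed.

End HFRelationsMorphism.

Section TensorInjections.
Variables (k : fieldType) (A B : algType k) (e : {lrmorphism A -> k^o}).
Local Notation T := (augmented_tensor B e).

Definition tensor_inl (a : A) : T := a ⊗ 1.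
Definition tensor_inr (b : B) : T := 1 ⊗ b.

Fact tensor_inl_linear : linear tensor_inl.
Proof. exact: tpure_linearl. Qed.

Fact tensor_inr_linear : linear tensor_inr.
Proof. exact: tpure_linearr. Qed.

Fact tensor_inl_monoid_morphism : monoid_morphism tensor_inl.
Proof. by split=> // x y; rewrite [RHS]tpureM mulr1. Qed.

Fact tensor_inr_monoid_morphism : monoid_morphism tensor_inr.
Proof. by split=> // x y; rewrite [RHS]tpureM mulr1. Qed.

HB.instance Definition _ := GRing.isLinear.Build k A T _ tensor_inl
  tensor_inl_linear.
HB.instance Definition _ := GRing.isMonoidMorphism.Build A T tensor_inl
  tensor_inl_monoid_morphism.
HB.instance Definition _ := GRing.isLinear.Build k B T _ tensor_inr
  tensor_inr_linear.
HB.instance Definition _ := GRing.isMonoidMorphism.Build B T tensor_inr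
  tensor_inr_monoid_morphism.

Lemma tensor_inlM a b : tensor_inl a * tensor_inr b = a ⊗ b :> T.
Proof. by rewrite [LHS]tpureM mulr1 mul1r. Qed.

Lemma tensor_inj_comm (m n p q : nat) (X : 'M[A]_(m, n)) (Y : 'M[B]_(p, q))
    i j i' j' :
  (map_mx tensor_inl X) i j * (map_mx tensor_inr Y) i' j' =
  (map_mx tensor_inr Y) i' j' * (map_mx tensor_inl X) i j.
Proof.
by rewrite !mxE tensor_inlM; rewrite [RHS]tpureM mulr1 mul1r.
Qed.

Lemma mulmx_tensor_inj (n : nat) (X : 'M[A]_n) (Y : 'M[B]_n) i j :
  (map_mx tensor_inl X *m map_mx tensor_inr Y) i j = \sum_l X i l ⊗ Y l j :> T.
Proof. by rewrite mxE; apply: eq_bigr => l _; rewrite !mxE tensor_inlM. Qed.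

End TensorInjections.

Section HFInduction.
Variables (k : fieldType).

Lemma freealg_ind (X : choiceType) (P : freealg k X -> Prop) :
  P 1 -> (forall c x y, P x -> P y -> P (c *: x + y)) ->
  (forall x y, P x -> P y -> P (x * y)) ->
  (forall x, P (freealg_gen k x)) -> forall x, P x.
Proof.
move=> P1 PDZ PM Pg x.
have P0 : P 0 by rewrite -[0](addNr 1) -scaleN1r; exact: PDZ.
have Pm (m : {fmonom X}) : P (<< m >> : freealg k X).
  case: m; elim=> [|y s IHs].
    by have -> : << FMonom [::] >> = 1 :> freealg k X by rewrite -fmoneE.
  have -> : << FMonom (y :: s) >> =
      freealg_gen k y * << FMonom s >> :> freealg k X.
    rewrite [RHS]fgmulUU mulr1; congr (<< 1 *g _ >>).
    by apply/val_inj; rewrite /= fmM fmU.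
  exact: PM.
rewrite [x]monalgE; elim/big_ind: _ => // [y z Py Pz|m _].
  by rewrite -[y]scale1r; exact: PDZ.
have -> : << x@_m *g m >> = x@_m *: << m >> + 0 :> freealg k X.
  apply/malgP=> m'; rewrite addr0 [RHS]mcoeffZ !mcoeffU.
  by rewrite mulrnAr mulr1.
exact: PDZ.
Qed.

Lemma HF_ind (n : nat) (F : glmx k n) (P : HF F -> Prop) :
  P 1 -> (forall c x y, P x -> P y -> P (c *: x + y)) ->
  (forall x y, P x -> P y -> P (x * y)) ->
  (forall i j, P (HF_u F i j)) -> (forall i j, P (HF_v F i j)) -> forall x, P x.
Proof.
move=> P1 PDZ PM Pu Pv x; rewrite -[x]HF_reprK.
apply: (freealg_ind (P := fun y => P (HF_pi F y))) => [|c y z Py Pz|y z Py Pz|].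
- by rewrite rmorph1.
- by rewrite linearP; exact: PDZ.
- by rewrite rmorphM; exact: PM.
- case=> [] [i j].
    by have := Pu i j; rewrite !mxE.
  by have := Pv i j; rewrite !mxE.
Qed.

End HFInduction.

Section HFEvalEntries.
Variables (k : fieldType) (n : nat) (F : glmx k n) (B : algType k).
Variables (U V : 'M[B]_n) (UV : HF_relations F U V).

Lemma HF_eval_uE i j : HF_eval UV (HF_u F i j) = U i j.
Proof. by have /matrixP/(_ i j) := HF_eval_u UV; rewrite mxE. Qed.

Lemma HF_eval_vE i j : HF_eval UV (HF_v F i j) = V i j.
Proof. by have /matrixP/(_ i j) := HF_eval_v UV; rewrite mxE. Qed.

End HFEvalEntries.

(* Naming the packaged structure keeps the tensor square of [HF F] in the form
   that the projections of [hopf] use, which unification relies on. *)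
Definition HF_alg (k : fieldType) (n : nat) (F : glmx k n) : algType k := HF F.

Section HFHopf.
Variables (k : fieldType) (n : nat) (F : glmx k n).
Local Notation H := (HF_alg F).
Local Notation u := (HF_u F : 'M[H]_n).
Local Notation v := (HF_v F : 'M[H]_n).

Let Fu : (F : 'M[k]_n) \in unitmx := glmx_unit F.

Let FTu : (F : 'M[k]_n)^T \in unitmx.
Proof. by rewrite unitmx_tr. Qed.

Lemma amx_regular (M : 'M[k]_n) : amx k^o M = M.
Proof. by apply/matrixP=> i j; rewrite !mxE /= [LHS]mulr1. Qed.

Fact HF_counit_rel : @HF_relations k n F k^o 1%:M 1%:M.
Proof.
rewrite /HF_relations !amx_regular trmx1 !mul1mx !mulmx1.
by split=> //; exact: mulmxV.
Qed.

Definition HF_counit : {lrmorphism H -> k^o} := HF_eval HF_counit_rel.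

Lemma HF_counit_u i j : HF_counit (u i j) = (i == j)%:R.
Proof.
by apply: etrans (HF_eval_uE HF_counit_rel i j) _; rewrite mxE.
Qed.

Lemma HF_counit_v i j : HF_counit (v i j) = (i == j)%:R.
Proof.
by apply: etrans (HF_eval_vE HF_counit_rel i j) _; rewrite mxE.
Qed.

Local Notation T := (augmented_tensor H HF_counit).
Local Notation inl_mx := (map_mx (@tensor_inl k H H HF_counit)).
Local Notation inr_mx := (map_mx (@tensor_inr k H H HF_counit)).

Fact HF_comul_rel :
  @HF_relations k n F T (inl_mx u *m inr_mx u) (inl_mx v *m inr_mx v).
Proof.
(* As a matrix, [Δ u] is the product of [u ⊗ 1] and [1 ⊗ u], whose entries commute with each other;
   likewise for [v]. *)
apply: HF_relations_mul; try exact/HF_relations_map/HF_uvP.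
  exact: tensor_inj_comm.
exact: tensor_inj_comm.
Qed.

Definition HF_comul (x : H) : (H ⊗ H)%type := HF_eval HF_comul_rel x.

Fact HF_comul_linear : linear HF_comul.
Proof. exact: (HF_eval_linear HF_comul_rel). Qed.

HB.instance Definition _ := GRing.isLinear.Build k H (H ⊗ H)%type _ HF_comul
  HF_comul_linear.

Fact HF_comul_monoid_morphism : monoid_morphism HF_comul.
Proof. exact: (HF_eval_monoid_morphism HF_comul_rel). Qed.

Lemma HF_comul_u i j : HF_comul (u i j) = \sum_l u i l ⊗ u l j.
Proof.
exact: etrans (HF_eval_uE HF_comul_rel i j) (mulmx_tensor_inj _ _ _ _ _).
Qed.

Lemma HF_comul_v i j : HF_comul (v i j) = \sum_l v i l ⊗ v l j.
Proof.
exact: etrans (HF_eval_vE HF_comul_rel i j) (mulmx_tensor_inj _ _ _ _ _).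
Qed.

Lemma HF_u_multiplicative : multiplicative_family HF_comul HF_counit u.
Proof. by split=> i j; rewrite (HF_comul_u, HF_counit_u). Qed.

Lemma HF_v_multiplicative : multiplicative_family HF_comul HF_counit v.
Proof. by split=> i j; rewrite (HF_comul_v, HF_counit_v). Qed.

Fact HF_antipode_rel : @HF_relations k n F (opposite H)
  v^T (amx H F *m u^T *m amx H (invmx F)).
Proof. exact/HF_relations_antipode/HF_uvP. Qed.

Fact HF_antipode_inv_rel : @HF_relations k n F (opposite H)
  (amx H F^T *m v^T *m amx H (invmx F^T)) u^T.
Proof. exact/HF_relations_antipode_inv/HF_uvP. Qed.

Definition HF_antipode (x : H) : H := HF_eval HF_antipode_rel x.
Definition HF_antipode_inv (x : H) : H := HF_eval HF_antipode_inv_rel x.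

Fact HF_antipode_linear : linear HF_antipode.
Proof. exact: (HF_eval_linear HF_antipode_rel). Qed.

Fact HF_antipode_inv_linear : linear HF_antipode_inv.
Proof. exact: (HF_eval_linear HF_antipode_inv_rel). Qed.

HB.instance Definition _ := GRing.isLinear.Build k H H _ HF_antipode
  HF_antipode_linear.

Lemma HF_antipodeM x y : HF_antipode (x * y) = HF_antipode y * HF_antipode x.
Proof. exact: (opposite_morphM (HF_eval HF_antipode_rel)). Qed.

Lemma HF_antipode_invM x y :
  HF_antipode_inv (x * y) = HF_antipode_inv y * HF_antipode_inv x.
Proof. exact: (opposite_morphM (HF_eval HF_antipode_inv_rel)). Qed.

Lemma HF_antipode1 : HF_antipode 1 = 1.
Proof. exact: (HF_eval_monoid_morphism HF_antipode_rel).1. Qed.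

Lemma HF_antipode_inv1 : HF_antipode_inv 1 = 1.
Proof. exact: (HF_eval_monoid_morphism HF_antipode_inv_rel).1. Qed.

Lemma HF_antipode_u : map_mx HF_antipode u = v^T.
Proof. exact: (HF_eval_u HF_antipode_rel). Qed.

Lemma HF_antipode_v :
  map_mx HF_antipode v = amx H F *m u^T *m amx H (invmx F).
Proof. exact: (HF_eval_v HF_antipode_rel). Qed.

Lemma HF_antipode_inv_u :
  map_mx HF_antipode_inv u = amx H F^T *m v^T *m amx H (invmx F^T).
Proof. exact: (HF_eval_u HF_antipode_inv_rel). Qed.

Lemma HF_antipode_inv_v : map_mx HF_antipode_inv v = u^T.
Proof. exact: (HF_eval_v HF_antipode_inv_rel). Qed.

Lemma HF_generated : generated_by u v.
Proof. exact: HF_ind. Qed.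

Lemma HF_u_antipodal : antipodal_family HF_antipode u.
Proof.
have [E1 E2 _ _] : HF_relations F u v := HF_uvP F.
exact (antipodal_mx HF_antipode_u E2 E1).
Qed.

Lemma HF_v_antipodal : antipodal_family HF_antipode v.
Proof.
have [_ _ E3 E4] : HF_relations F u v := HF_uvP F.
apply: (antipodal_mx HF_antipode_v); first exact E4.
rewrite !mulmxA; exact E3.
Qed.

Definition HF_hopf : hopf H :=
  hopf_of_generators HF_comul_monoid_morphism HF_antipodeM HF_antipode1
    HF_generated HF_u_multiplicative HF_v_multiplicative
    HF_u_antipodal HF_v_antipodal.

(** The composite of two anti-multiplicative maps is multiplicative, so it is the identity once it
    fixes [u] and [v]. *)
Lemma antipode_cancel_generators (S S' : H -> H) :
  linear S -> linear S' -> S 1 = 1 -> S' 1 = 1 ->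
  (forall x y, S (x * y) = S y * S x) ->
  (forall x y, S' (x * y) = S' y * S' x) ->
  (exists2 X, map_mx S u = X & map_mx S' X = u) ->
  (exists2 X, map_mx S v = X & map_mx S' X = v) -> cancel S S'.
Proof.
move=> SL S'L S1 S'1 SM S'M [X <- Su] [Y <- Sv].
apply: HF_generated => [|c x y Hx Hy|x y Hx Hy|i j|i j].
- by rewrite S1.
- by rewrite SL S'L Hx Hy.
- by rewrite SM S'M Hx Hy.
- by have := congr1 (fun X : 'M[H]_n => X i j) Su; rewrite !mxE.
- by have := congr1 (fun X : 'M[H]_n => X i j) Sv; rewrite !mxE.
Qed.

Fact HF_antipodeK : cancel HF_antipode HF_antipode_inv.
Proof.
apply: (antipode_cancel_generators HF_antipode_linear HF_antipode_inv_linear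
  HF_antipode1 HF_antipode_inv1 HF_antipodeM HF_antipode_invM).
- by exists v^T; [exact HF_antipode_u | exact (map_mx_tr_eq HF_antipode_inv_v)].
- exists (amx H F *m u^T *m amx H (invmx F)); first exact HF_antipode_v.
  exact (map_mx_conj_eq HF_antipode_inv_linear Fu HF_antipode_inv_u).
Qed.

Fact HF_antipode_invK : cancel HF_antipode_inv HF_antipode.
Proof.
have conj_v : map_mx HF_antipode v =
    amx H F^T^T *m u^T *m amx H (invmx F^T^T).
  by rewrite trmxK; exact HF_antipode_v.
apply: (antipode_cancel_generators HF_antipode_inv_linear HF_antipode_linear
  HF_antipode_inv1 HF_antipode1 HF_antipode_invM HF_antipodeM).
- exists (amx H F^T *m v^T *m amx H (invmx F^T)); first exact HF_antipode_inv_u.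
  exact (map_mx_conj_eq HF_antipode_linear FTu conj_v).
- by exists u^T; [exact HF_antipode_inv_v | exact (map_mx_tr_eq HF_antipode_u)].
Qed.

Definition HF_bijhopf : bijhopf H :=
  @BijHopf k H HF_hopf HF_antipode_inv HF_antipodeK HF_antipode_invK.

Fact HF_character_rel : @HF_relations k n F k^o F^T (invmx F).
Proof.
apply/HF_relationsP; rewrite !amx_regular !trmxK; split.
- by rewrite -[LHS]trmx_mul mulVmx // trmx1.
- by rewrite -[LHS]trmx_mul mulmxV // trmx1.
- by rewrite mulVmx // mul1mx.
- by rewrite mulmxV // mul1mx.
Qed.

(** These are the values of the character composed with the antipode: [v^T] goes to [F^-T], and
    [F u^T F^-1] goes to [F F F^-1 = F]. *)
Fact HF_character_inv_rel : @HF_relations k n F k^o (invmx F^T) F.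
Proof.
apply/HF_relationsP; rewrite !amx_regular -trmx_inv !trmxK; split.
- by rewrite -[LHS]trmx_mul mulmxV // trmx1.
- by rewrite -[LHS]trmx_mul mulVmx // trmx1.
- by rewrite mulmxK.
- by rewrite mulmxKV.
Qed.

Definition HF_character : {lrmorphism H -> k^o} := HF_eval HF_character_rel.
Definition HF_character_inv : {lrmorphism H -> k^o} :=
  HF_eval HF_character_inv_rel.

Lemma HF_character_u : map_mx HF_character u = F^T.
Proof. exact (HF_eval_u HF_character_rel). Qed.

Lemma HF_character_v : map_mx HF_character v = invmx F.
Proof. exact (HF_eval_v HF_character_rel). Qed.

Lemma HF_character_inv_u : map_mx HF_character_inv u = invmx F^T.
Proof. exact (HF_eval_u HF_character_inv_rel). Qed.

Lemma HF_character_inv_v : map_mx HF_character_inv v = F.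
Proof. exact (HF_eval_v HF_character_inv_rel). Qed.

Lemma HF_sovereign : sovereign HF_bijhopf HF_character.
Proof.
have VF := mulVmx Fu; have FV := mulmxV Fu.
have VT := mulVmx FTu; have TV := mulmxV FTu.
have uM : multiplicative_family (comul HF_bijhopf) (counit HF_bijhopf) u.
  exact HF_u_multiplicative.
have vM : multiplicative_family (comul HF_bijhopf) (counit HF_bijhopf) v.
  exact HF_v_multiplicative.
apply: (@sovereign_of_generators k H HF_bijhopf _ _ _ HF_character
  HF_character_inv HF_generated uM vM).
- exact (convolution_mx_entries HF_character_u HF_character_inv_u TV).
- exact (convolution_mx_entries HF_character_inv_u HF_character_u VT).
- exact (convolution_mx_entries HF_character_v HF_character_inv_v VF).
- exact (convolution_mx_entries HF_character_inv_v HF_character_v FV).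
- exact (sovereign_mx_entries HF_character_u HF_antipode_u HF_character_inv_u
    HF_antipode_inv_u).
(* Here [Phi(v) S(v) Psi(v) = F^-1 (F u^T F^-1) F = u^T]; for [u], the product is literally the
   formula for [S^-1 u]. *)
- apply (sovereign_mx_entries HF_character_v HF_antipode_v HF_character_inv_v).
  etransitivity; first exact HF_antipode_inv_v.
  exact (esym (amx_conjK _ Fu)).
Qed.

Definition HF_cosovereign : cosovereign H := Cosovereign HF_sovereign.

End HFHopf.

(** * Universality of H(F) *)

Lemma eq_multiplicative_family (k : fieldType) (A : algType k)
    (D : A -> (A ⊗ A)%type) (e : {lrmorphism A -> k^o}) (I : finType)
    (a b : I -> I -> A) :
  (forall i j, a i j = b i j) ->
  multiplicative_family D e b -> multiplicative_family D e a.
Proof.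
move=> ab [bD be]; split=> i j; rewrite ab ?be // bD.
by apply: eq_bigr => l _; rewrite !ab.
Qed.

Section UniversalRelations.
Variables (k : fieldType) (n : nat) (F : glmx k n) (A : algType k).
Variables (hA : bijhopf A) (a : 'M[A]_n).
Hypothesis aM : multiplicative_family (comul hA) (counit hA) a.
Hypothesis aF : (map_mx (antipode hA) a)^T *m amx A F =
  amx A F *m (map_mx (antipode_inv hA) a)^T.

(** The first two relations say that [S a] inverts [a]. For the others, [aF] rewrites [S(a)^T] as
    the conjugate by [F] of [S^-1(a)^T], which inverts [a^T]. *)
Lemma multiplicative_HF_relations :
  HF_relations F a (map_mx (antipode hA) a)^T.
Proof.
have Fu := glmx_unit F.
have SaF : amx A F *m (map_mx (antipode_inv hA) a)^T *m amx A (invmx F) =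
    (map_mx (antipode hA) a)^T.
  by rewrite -aF amx_mulrV.
split.
- apply/matrixP=> i j; rewrite !mxE -(antipode_familyr aM).
  by apply: eq_bigr => l _; rewrite !mxE.
- apply/matrixP=> i j; rewrite !mxE -(antipode_familyl aM).
  by apply: eq_bigr => l _; rewrite !mxE.
- rewrite aF -[_ *m _ *m a^T]mulmxA [_ *m a^T](_ : _ = 1%:M).
    by rewrite mulmx1 -amxM mulmxV // amx1.
  apply/matrixP=> i j; rewrite !mxE eq_sym -(antipode_inv_familyl aM).
  by apply: eq_bigr => l _; rewrite !mxE.
- rewrite -SaF !mulmxA amx_mulrVK // -[_ *m a^T *m _]mulmxA.
  rewrite [a^T *m _](_ : _ = 1%:M).
    by rewrite mulmx1 -amxM mulmxV // amx1.
  apply/matrixP=> i j; rewrite !mxE eq_sym -(antipode_inv_familyr aM).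
  by apply: eq_bigr => l _; rewrite !mxE.
Qed.

End UniversalRelations.

Section Universality.
Variables (k : fieldType) (n : nat) (F : glmx k n) (A : algType k).
Variables (hA : bijhopf A) (a : 'M[A]_n).
Hypothesis aM : multiplicative_family (comul hA) (counit hA) a.
Hypothesis aF : (map_mx (antipode hA) a)^T *m amx A F =
  amx A F *m (map_mx (antipode_inv hA) a)^T.

(** The image of [v] has to be [S(a)^T]; it is multiplicative because the antipode reverses the
    comultiplication. *)
Lemma HF_universal : exists pi : {lrmorphism HF F -> A},
  hopf_morphism (HF_cosovereign F) hA pi /\
  forall i j, pi (HF_u F i j) = a i j.
Proof.
have rel := multiplicative_HF_relations aM aF.
pose pi : {lrmorphism HF_alg F -> A} := HF_eval rel.
have piu i j : pi (HF_u F i j) = a i j by exact (HF_eval_uE rel i j).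
have piv i j : pi (HF_v F i j) = antipode hA (a j i).
  by apply: etrans (HF_eval_vE rel i j) _; rewrite !mxE.
exists pi; split=> //.
apply: (@hopf_morphism_of_generators k (HF_alg F) A (HF_cosovereign F) hA _
  _ _ pi (@HF_generated k n F)).
- exact (HF_u_multiplicative F).
- exact (HF_v_multiplicative F).
- exact: (eq_multiplicative_family piu aM).
- exact: (eq_multiplicative_family piv (antipode_multiplicative_family aM)).
Qed.

End Universality.

(** * Matrices attached to dual comodules and to sovereign characters *)

Section DualComodules.
Variables (k : fieldType) (A : algType k) (V : vectType k) (n : nat).
Variables (e : n.-tuple V).
Hypothesis eB : basis_of fullv e.
Local Notation dual := 'Hom(V, k^o).

(** Evaluation at [x] as a linear form on the dual, so that [contractl] extracts coefficients from
    tensors in [dual ⊗ A]. *)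
Definition lfun_eval (x : V) (g : dual) : k^o := g x.

Fact lfun_eval_linear x : linear (lfun_eval x).
Proof. by move=> c g h; rewrite /lfun_eval add_lfunE scale_lfunE. Qed.

HB.instance Definition _ x :=
  GRing.isLinear.Build k dual k^o _ (lfun_eval x) (lfun_eval_linear x).

Lemma dual_basisE (i j : 'I_n) : dual_basis e i e`_j = (i == j)%:R.
Proof. by rewrite lfunE /= (coord_basisE eB) eq_sym. Qed.

Lemma dual_basis_sum (g : dual) : g = \sum_(i < n) g e`_i *: dual_basis e i.
Proof.
apply/lfunP; apply: (basis_linear_ext eB) => [||j]; try exact: linearP.
rewrite sum_lfunE.
under eq_bigr => i _ do rewrite scale_lfunE dual_basisE.
by rewrite -[RHS]/(\sum_(i < n) (g e`_i : k) * (i == j)%:R) (sum_deltar (R := k)).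
Qed.

Lemma dual_coaction_eval (T : A -> A) (alpha : V -> (V ⊗ A)%type) (g : dual)
    (l : 'I_n) :
  contractl (lfun_eval e`_l) (dual_coaction e T alpha g) =
  \sum_(i < n) g e`_i *: T (coaction_mx e alpha i l).
Proof.
rewrite /dual_coaction linear_sum; apply: eq_bigr => i _.
rewrite linearZ /= contractl_sum.
under eq_bigr => j _ do rewrite /= /lfun_eval dual_basisE eq_sym.
by rewrite sum_deltaZ.
Qed.

Definition dual_mx (f : dual -> dual) : 'M[k]_n :=
  \matrix_(i, j) (f (dual_basis e j) e`_i : k).

Lemma dual_mx_inv (f g : dual -> dual) :
  linear f -> cancel g f -> dual_mx f *m dual_mx g = 1%:M.
Proof.
move=> fL gK; apply/matrixP=> i j; rewrite !mxE.
rewrite eq_sym -[RHS](dual_basisE j i) -[dual_basis e j in RHS]gK.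
rewrite [g _ in RHS]dual_basis_sum (lin_sum fL) sum_lfunE.
by apply: eq_bigr => l _; rewrite !mxE (linZ fL) scale_lfunE mulrC.
Qed.

Lemma dual_mx_unit (f : {linear dual -> dual}) :
  bijective f -> dual_mx f \in unitmx.
Proof.
case=> g fK gK; have [] // := mulmx1_unit (dual_mx_inv (linearP f) gK).
Qed.

(** Compares the coefficients at [e_l^*] of the images of [e_i^*]. With [T] the antipode and [T']
    its inverse, the result is the hypothesis [aF] of [HF_universal]. *)
Lemma dual_mx_intertwines (T T' : A -> A) (alpha : V -> (V ⊗ A)%type)
    (f : {linear dual -> dual}) :
  (forall g, dual_coaction e T alpha (f g) =
             tmap f idfun (dual_coaction e T' alpha g)) ->
  (map_mx T (coaction_mx e alpha))^T *m amx A (dual_mx f) =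
  amx A (dual_mx f) *m (map_mx T' (coaction_mx e alpha))^T.
Proof.
move=> fT; apply/matrixP=> l i.
have := congr1 (contractl (lfun_eval e`_l)) (fT (dual_basis e i)).
rewrite dual_coaction_eval {1}/dual_coaction.
under [X in _ = contractl _ (tmap _ _ X) -> _]eq_bigr
  => j _ do rewrite dual_basisE.
rewrite sum_deltaZ tmap_sum contractl_sum /lfun_eval /= => E.
rewrite !mxE; apply: etrans (etrans E _).
  by apply: eq_bigr => j _; rewrite !mxE mulr_algr.
by apply: eq_bigr => j _; rewrite !mxE mulr_algl.
Qed.

End DualComodules.

Section SovereignMatrix.
Variables (k : fieldType) (A : algType k) (hA : cosovereign A).
Variables (n : nat) (a : 'M[A]_n).
Hypothesis aM : multiplicative_family (comul hA) (counit hA) a.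
Local Notation Phi := (sovereign_character hA).

Lemma sovereign_mx :
  (map_mx Phi a : 'M[k]_n)^T \in unitmx /\
  (map_mx (antipode hA) a)^T *m amx A (map_mx Phi a : 'M[k]_n)^T =
  amx A (map_mx Phi a : 'M[k]_n)^T *m (map_mx (antipode_inv hA) a)^T.
Proof.
have [Psi [PP' P'P] S'E] := sovereign_characterP hA.
set P : 'M[k]_n := map_mx Phi a; pose Q : 'M[k]_n := map_mx Psi a.
have PhiL : linear Phi := linearP Phi.
have PsiL : linear Psi := linearP Psi.
have PQ : P *m Q = 1%:M.
  apply/matrixP=> i j; rewrite !mxE -(aM.2 i j) -PP'.
  rewrite (convolution_family PhiL PsiL _ _ aM).
  by apply: eq_bigr => l _; rewrite !mxE.
have [Pu Qu] := mulmx1_unit PQ.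
have charL (f : A -> k^o) : linear f -> linear (fun x => (f x)%:A : A).
  by move=> fL c x y; rewrite fL scalerDl scalerA.
have SL : linear (antipode hA) := linearP _.
have PSL := convolution_linear hA (charL _ PhiL) SL.
have S'a : map_mx (antipode_inv hA) a =
    amx A P *m map_mx (antipode hA) a *m amx A Q.
  apply/matrixP=> i j; rewrite !mxE S'E.
  rewrite (convolution_family PSL (charL _ PsiL) _ _ aM).
  apply: eq_bigr => m _; rewrite (convolution_family (charL _ PhiL) SL _ _ aM).
  rewrite !mxE; congr (_ * _).
  by apply: eq_bigr => l _; rewrite !mxE.
split; first by rewrite unitmx_tr.
rewrite S'a trmx_amx_mulr trmx_amx_mull !mulmxA -amxM -trmx_mul.
have -> : Q *m P = 1%:M by exact: mulmx1C.
by rewrite trmx1 amx1 mul1mx.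
Qed.

End SovereignMatrix.

Section Consequences.
Variables (k : fieldType) (A : algType k).

Lemma HF_coaction_quotient (hA : bijhopf A) (V : vectType k) (n : nat)
    (e : n.-tuple V) (alpha : {linear V -> (V ⊗ A)%type}) :
  basis_of fullv e -> coaction hA alpha ->
  comodule_iso (right_dual e hA alpha) (left_dual e hA alpha) ->
  exists (F : glmx k n) (beta : {linear V -> (V ⊗ HF_alg F)%type})
         (pi : {lrmorphism HF F -> A}),
    [/\ coaction (HF_cosovereign F) beta,
        hopf_morphism (HF_cosovereign F) hA pi
      & forall x : V, tmap idfun pi (beta x) = alpha x].
Proof.
move=> eB aC [f fbij fiso].
have aM := coaction_mx_multiplicative eB aC.
pose F : glmx k n := exist _ (dual_mx e f) (dual_mx_unit eB fbij).
have [pi [pi_hopf piu]] :=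
  @HF_universal k n F A hA _ aM (dual_mx_intertwines eB fiso).
(* This coaction has coefficient matrix [u], which [pi] sends to the coefficient matrix of
   [alpha]. *)
exists F, (family_coaction e (HF_u F : 'M[HF_alg F]_n)), pi; split=> //.
  apply: (family_coactionP (hA := HF_cosovereign F) eB).
  exact (HF_u_multiplicative F).
apply: (basis_linear_ext eB) => [||i].
- by apply: lin_comp; [exact: tmap_linear | exact: family_coaction_linear].
- exact: linearP.
rewrite /= (family_coactionE eB) tmap_sum (coaction_mxE eB).
by apply: eq_bigr => j _; rewrite /= piu.
Qed.

Lemma HF_cosovereign_quotient (hA : cosovereign A) :
  finite_type A ->
  exists (n : nat) (F : glmx k n) (pi : {lrmorphism HF F -> A}),
    [/\ (0 < n)%N, hopf_morphism (HF_cosovereign F) hA pi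
      & forall a : A, exists x : HF F, pi x = a].
Proof.
move=> [s sA]; have [n [a0 [n0 a0M as_]]] := multiplicative_family_seq hA s.
pose a : 'M[A]_n := \matrix_(i, j) a0 i j.
have aE i j : a i j = a0 i j by rewrite mxE.
have aM := eq_multiplicative_family aE a0M.
have [Fu aF] := sovereign_mx aM.
pose F : glmx k n := exist (fun M : 'M[k]_n => M \in unitmx) _ Fu.
have [pi [pi_hopf piu]] := @HF_universal k n F A hA _ aM aF.
(* The range of [pi] is a subalgebra, and each element of [s] is a combination of the entries
   [a i j], the images of the [u i j]. *)
exists n, F, pi; split=> // x; elim: (sA x) => {x}.
- move=> x /as_[c ->]; exists (\sum_i \sum_j c i j *: HF_u F i j).
  rewrite linear_sum; apply: eq_bigr => i _.
  rewrite linear_sum; apply: eq_bigr => j _.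
  by rewrite linearZ /= piu aE.
- by exists 1; rewrite rmorph1.
- by move=> c _ _ _ [x <-] _ [y <-]; exists (c *: x + y); rewrite linearP.
- by move=> _ _ _ [x <-] _ [y <-]; exists (x * y); rewrite rmorphM.
Qed.

End Consequences.

(** One structure [h] is fixed for all [n] and [F], so both universality clauses concern the very
    structure that the formulas describe. *)
Theorem theorem4p2 (k : fieldType) :
  exists h : forall (n : nat) (F : glmx k n), cosovereign (HF F),
    (* the structure of H(F) *)
    (forall (n : nat) (F : glmx k n),
       let u := HF_u F in
       let v := HF_v F in
       let S := antipode (h n F) in
       let Sinv := antipode_inv (h n F) in
       let Phi := sovereign_character (h n F) in
       [/\ (forall i j, comul (h n F) (u i j) = \sum_(l < n) u i l ⊗ u l j)
             /\ (forall i j, comul (h n F) (v i j) = \sum_(l < n) v i l ⊗ v l j),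
           (forall i j, counit (h n F) (u i j) = (i == j)%:R)
             /\ (forall i j, counit (h n F) (v i j) = (i == j)%:R),
           map_mx S u = v^T
             /\ map_mx S v = amx _ F *m u^T *m amx _ (invmx F),
           map_mx Sinv u = amx _ F^T *m v^T *m amx _ (invmx F^T)
             /\ map_mx Sinv v = u^T
         & map_mx Phi u = F^T :> 'M[k]_n
             /\ map_mx Phi v = invmx F :> 'M[k]_n])
    /\
    (* universality for comodules with isomorphic left and right duals *)
    (forall (A : algType k) (hA : bijhopf A) (V : vectType k) (n : nat)
            (e : n.-tuple V) (alpha : {linear V -> (V ⊗ A)%type}),
       basis_of fullv e -> coaction hA alpha ->
       comodule_iso (right_dual e hA alpha) (left_dual e hA alpha) ->
       exists (F : glmx k n) (beta : {linear V -> (V ⊗ HF F)%type})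
              (pi : {lrmorphism HF F -> A}),
         [/\ coaction (h n F) beta,
             hopf_morphism (h n F) hA pi
           & forall x : V, tmap idfun pi (beta x) = alpha x])
    /\
    (* finite type cosovereign Hopf algebras are quotients of the H(F) *)
    (forall (A : algType k) (hA : cosovereign A),
       finite_type A ->
       exists (n : nat) (F : glmx k n) (pi : {lrmorphism HF F -> A}),
         [/\ (0 < n)%N, hopf_morphism (h n F) hA pi
           & forall a : A, exists x : HF F, pi x = a]).
Proof.
exists (fun n F => HF_cosovereign F); split=> [n F u v S Sinv Phi|].
  split.
  - by split=> i j; [exact (HF_comul_u F i j) | exact (HF_comul_v F i j)].
  - by split=> i j; [exact (HF_counit_u F i j) | exact (HF_counit_v F i j)].
  - by split; [exact (HF_antipode_u F) | exact (HF_antipode_v F)].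
  - by split; [exact (HF_antipode_inv_u F) | exact (HF_antipode_inv_v F)].
  - by split; [exact (HF_character_u F) | exact (HF_character_v F)].
split=> [A hA V n e alpha|A hA].
  exact (@HF_coaction_quotient k A hA V n e alpha).
exact (@HF_cosovereign_quotient k A hA).
Qed.
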